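(* There exists $L_o>0$ such that for any $0<L<L_o$ there exists a self-involute curve of length $L$ on the unit sphere $S^2$.
   Context: Let $\eta:[0,L]\to S^2\subset\mathbb R^3$ be a curve parameterized by arc length and $\mathcal C^1$ on $(0,L)$. The involute of $\eta$ is the curve $\widetilde\eta:[0,L]\to S^2$ such that, for any $s\in(0,L)$, $\widetilde\eta_s$ is the point at parameter $s$ of the unit-speed geodesic starting at $\eta_s$ with initial velocity $-\dot\eta_s$; explicitly $$\widetilde\eta_s=\cos(s)\,\eta_s-\sin(s)\,\dot\eta_s$$ (extended by continuity to the endpoints). The curve $\eta$ is called self-involute if it coincides with the initial arc of length $L$ of its own involute $\widetilde\eta$, re-parameterized by arc length. *)

(* Defs.v *)
From HB Require Import structures.
From mathcomp Require Import all_boot all_order all_algebra.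
From mathcomp Require Import all_classical all_reals all_analysis.

Set Implicit Arguments.
Unset Strict Implicit.
Unset Printing Implicit Defensive.

Import Order.TTheory GRing.Theory Num.Theory.
Import numFieldNormedType.Exports.

Local Open Scope classical_set_scope.
Local Open Scope ring_scope.

(* A curve on [0, L] is a total function R -> 'rV[R]_3 of which only the values
   on [0, L] are constrained. *)

(* The norm `| v | of 'rV[R]_3 is the sup norm; it defines the right topology,
   but lengths have to be measured with the Euclidean norm. *)
Definition enorm (R : realType) (v : 'rV[R]_3) : R :=
  Num.sqrt (\sum_(i < 3) v 0 i ^+ 2).

Definition unit_sphere (R : realType) : set 'rV[R]_3 := [set v | enorm v = 1].

(* Same shape as variation, variations and total_variation for real functions. *)
Definition polygonal_length (R : realType) (a b : R) (c : R -> 'rV[R]_3)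
    (s : seq R) : R :=
  let F := c \o nth b (a :: s) in
  \sum_(0 <= n < size s) enorm (F n.+1 - F n).

Definition curve_length (R : realType) (a b : R) (c : R -> 'rV[R]_3) : \bar R :=
  ereal_sup [set (polygonal_length a b c s)%:E | s in itv_partition a b].

Definition arclength_param (R : realType) (L : R) (c : R -> 'rV[R]_3) : Prop :=
  forall s t, 0 <= s -> s <= t -> t <= L -> curve_length s t c = (t - s)%:E.

Definition C1_oo (R : realType) (a b : R) (c : R -> 'rV[R]_3) : Prop :=
  {in `]a, b[, forall s, derivable c s 1} /\
  {in `]a, b[, continuous (derive1 c)}.

Definition spherical_curve (R : realType) (L : R) (eta : R -> 'rV[R]_3) : Prop :=
  [/\ forall s, s \in `[0, L] -> unit_sphere (eta s),
      arclength_param L eta & C1_oo 0 L eta].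

(* Continuity on the closed interval determines g at 0 and at L: these values
   are the limits of the formula. *)
Definition is_involute (R : realType) (L : R) (eta g : R -> 'rV[R]_3) : Prop :=
  (forall s, s \in `]0, L[ ->
     g s = cos s *: eta s - sin s *: derive1 eta s) /\
  {within `[0, L], continuous g}.

(* The arc of g over [0, S] has length l, and c is its arc-length
   re-parameterization: c takes at l(s) the value g s, where l(s) is the length
   of g between 0 and s. *)
Definition is_initial_arc (R : realType) (L l : R) (g c : R -> 'rV[R]_3) : Prop :=
  exists S : R, [/\ 0 <= S <= L,
    curve_length 0 S g = l%:E &
    forall s, s \in `[0, S] -> c (fine (curve_length 0 s g)) = g s].

Definition self_involute (R : realType) (L : R) (eta : R -> 'rV[R]_3) : Prop :=
  spherical_curve L eta /\
  exists g, is_involute L eta g /\ is_initial_arc L L g eta.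

(* Main.v *)
(* Idea. An involute has speed sin(s) |k(s)|, where k is the geodesic curvature
   of the curve, and geodesic curvature cot(s) at parameter s. A self-involute
   curve therefore has k(s) = cot(f(s)), where f is the inverse of the arc
   length of the involute: f' = tan(f o f) / sin(f), f(0) = 0. For every slope
   a < 1 this equation has a solution f(s) = a s + O(s^3), a fixed point of a
   monotone operator. The curve with curvature cot(f) is a spiral around its
   initial point, and its involute is congruent to it; the congruence is the
   identity as soon as the tangent turns by -pi/2 modulo 2 pi, which in the
   limit s -> 0 is the condition b ln b = 3 pi/2 on b = 1/a, as for logarithmic
   spirals. *)
Require Import Defs.
From mathcomp Require Import all_boot all_order all_algebra ring lra.
From mathcomp Require Import all_classical all_reals all_analysis.
From mathcomp Require Import measurable_realfun.
Import Order.TTheory GRing.Theory Num.Theory.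
Import numFieldNormedType.Exports.
Local Open Scope classical_set_scope.
Local Open Scope ring_scope.

Set Implicit Arguments.
Unset Strict Implicit.
Unset Printing Implicit Defensive.

(** * Derivatives and primitives on an interval *)

(** The obstacle is the endpoint 0. There the curvature grows like 1/(a s) and the angle of the
    tangent behaves like b ln s, so tangent and normal spin without a limit: neither the Frenet
    system nor the comparison of the curve with its involute can start from initial values at 0. The
    curve is therefore integrated in a parallel frame, whose coefficients are the cosine and sine of
    the angle and stay bounded. The comparison rests on a squared distance that is constant inside
    the interval and tends to 0 at 0. For this the angle condition has to hold only up to an error
    O(s). The condition arises as follows. The derivative of cos(s) X - sin(s) T is - sin(s) k(s) N,
    so the tangent of the involute is minus the normal of the curve, a turn by -pi/2. Since f(s)/s
    tends to a, the angle b ln s changes by b ln b, in the limit, from f(s) to s. The equation for f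
    is not an ordinary differential equation, because it contains f o f. The order argument needs
    f(s)/s to be nondecreasing: f also occurs in the denominator, and the quotient f(f(s))/f(s) has
    to grow with f. *)

Lemma is_derive1_continuous (R : realType) (f : R -> R) (x d : R) :
  is_derive x 1 f d -> {for x, continuous f}.
Proof. by case=> /derivable1_diffP /differentiable_continuous. Qed.

Lemma is_derive1_eq_itv (R : realType) (a b x d : R) (f g : R -> R) :
  x \in `]a, b[ -> (forall t, t \in `]a, b[ -> f t = g t) ->
  is_derive x 1 f d -> is_derive x 1 g d.
Proof.
move=> xab fg df.
apply: (near_eq_is_derive _ df).
near=> t; apply: fg; near: t; exact: near_in_itvoo.
Unshelve. all: by end_near. Qed.

Lemma is_derive1_add (R : realType) (f g : R -> R) (x a b : R) :
  is_derive x 1 f a -> is_derive x 1 g b ->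
  is_derive x 1 (fun t => f t + g t) (a + b).
Proof. by move=> fa gb; exact: is_deriveD. Qed.

Lemma is_derive1_sub (R : realType) (f g : R -> R) (x a b : R) :
  is_derive x 1 f a -> is_derive x 1 g b ->
  is_derive x 1 (fun t => f t - g t) (a - b).
Proof. by move=> fa gb; exact: is_deriveB. Qed.

Lemma is_derive1_mul (R : realType) (f g : R -> R) (x a b : R) :
  is_derive x 1 f a -> is_derive x 1 g b ->
  is_derive x 1 (fun t => f t * g t) (f x * b + g x * a).
Proof. by move=> fa gb; exact: is_deriveM. Qed.

Lemma is_derive1_scale (R : realType) (f : R -> R) (k x a : R) :
  is_derive x 1 f a -> is_derive x 1 (fun t => k * f t) (k * a).
Proof. by move=> fa; exact: is_deriveZ. Qed.

Lemma is_derive1_compose (R : realType) (f g : R -> R) (x a b : R) :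
  is_derive (g x) 1 f a -> is_derive x 1 g b ->
  is_derive x 1 (fun t => f (g t)) (a * b).
Proof. by move=> fa gb; exact: is_derive1_comp. Qed.

Lemma is_derive1_val (R : realType) (f : R -> R) (x a b : R) :
  is_derive x 1 f a -> a = b -> is_derive x 1 f b.
Proof. by move=> fa <-. Qed.

(** This form of regularity passes to the pointwise suprema and limits by which functions are
    constructed, and it gives continuity up to endpoints at which derivatives are not controlled. *)
Definition lipschitz_itv (R : realType) (C a b : R) (f : R -> R) :=
  forall s t, a <= s -> s <= t -> t <= b -> `|f t - f s| <= C * (t - s).

Lemma lipschitz_itvP (R : realType) (C a b : R) (f : R -> R) s t :
  lipschitz_itv C a b f -> s \in `[a, b] -> t \in `[a, b] ->
  `|f t - f s| <= C * `|t - s|.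
Proof.
move=> fC; rewrite !in_itv/= => /andP[as_ sb] /andP[at_ tb].
have [st|/ltW ts] := leP s t; first
  by rewrite [`|t - s|]ger0_norm ?subr_ge0// fC.
by rewrite distrC (distrC t) [`|s - t|]ger0_norm ?subr_ge0// fC.
Qed.

Lemma lipschitz_itv_continuous (R : realType) (C a b : R) (f : R -> R) :
  lipschitz_itv C a b f -> {within `[a, b], continuous f}.
Proof.
move=> fC; apply/subspace_continuousP => x xab.
apply/cvgrPdist_le => e e0.
have C0 : 0 < `|C| + 1 by rewrite ltr_pwDr.
rewrite near_withinE; near=> t => tab /=.
rewrite distrC (le_trans (lipschitz_itvP fC xab tab))//.
have : `|x - t| <= e / (`|C| + 1).
  by near: t; apply: (@cvgr_dist_le _ _ _ _ _ id); rewrite ?divr_gt0//;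
    exact: cvg_id.
rewrite ler_pdivlMr// distrC => h; apply: le_trans h.
rewrite mulrC ler_wpM2l//.
by rewrite (le_trans (ler_norm _))// lerDl.
Unshelve. all: by end_near. Qed.

Lemma within_continuous_sub (R : realType) (a b s t : R) (f : R -> R) :
  {within `[a, b], continuous f} -> a <= s -> t <= b ->
  {within `[s, t], continuous f}.
Proof.
move=> + as_ tb; apply: continuous_subspaceW.
by apply: subset_itv; rewrite bnd_simp.
Qed.

Lemma mean_value (R : realType) (f df : R -> R) (a b s t : R) :
  {within `[a, b], continuous f} ->
  (forall x, x \in `]a, b[ -> is_derive x 1 f (df x)) ->
  a <= s -> s < t -> t <= b ->
  exists c, [/\ s < c, c < t & f t - f s = df c * (t - s)].
Proof.
move=> fc fd as_ st tb.
have fd' x : x \in `]s, t[ -> is_derive x 1 f (df x).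
  rewrite in_itv/= => /andP[sx xt]; apply: fd.
  by rewrite in_itv/= (le_lt_trans as_ sx) (lt_le_trans xt tb).
have [c] := MVT st fd' (within_continuous_sub fc as_ tb).
by rewrite in_itv/= => /andP[sc ct] ->; exists c.
Qed.

Lemma lipschitz_itv_derive (R : realType) (C a b : R) (f df : R -> R) :
  {within `[a, b], continuous f} ->
  (forall x, x \in `]a, b[ -> is_derive x 1 f (df x)) ->
  (forall x, x \in `]a, b[ -> `|df x| <= C) ->
  lipschitz_itv C a b f.
Proof.
move=> fc fd dfC s t as_ + tb; rewrite le_eqVlt => /predU1P[->|st].
  by rewrite !subrr mulr0 normr0.
have [c [sc ct ->]] := mean_value fc fd as_ st tb.
rewrite normrM (ger0_norm (_ : 0 <= t - s)) ?subr_ge0 ?(ltW st)//.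
rewrite ler_wpM2r ?subr_ge0 ?(ltW st)// dfC// in_itv/=.
by rewrite (le_lt_trans as_ sc) (lt_le_trans ct tb).
Qed.

Lemma derive_ge0_le (R : realType) (a b : R) (f df : R -> R) :
  {within `[a, b], continuous f} ->
  (forall x, x \in `]a, b[ -> is_derive x 1 f (df x)) ->
  (forall x, x \in `]a, b[ -> 0 <= df x) ->
  forall s t, a <= s -> s <= t -> t <= b -> f s <= f t.
Proof.
move=> fc fd df0 s t as_ + tb; rewrite le_eqVlt => /predU1P[->//|st].
have [c [sc ct E]] := mean_value fc fd as_ st tb.
rewrite -subr_ge0 E mulr_ge0 ?subr_ge0 ?(ltW st)// df0// in_itv/=.
by rewrite (le_lt_trans as_ sc) (lt_le_trans ct tb).
Qed.

Lemma primitive_bounded (R : realType) (L C : R) (h : R -> R) : 0 < L ->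
  {in `]0, L[, continuous h} -> (forall x, x \in `]0, L[ -> `|h x| <= C) ->
  exists G : R -> R, [/\ G 0 = 0, lipschitz_itv C 0 L G &
    forall x, x \in `]0, L[ -> is_derive x 1 G (h x)].
Proof.
move=> L0 hc hC.
pose mu := @lebesgue_measure R.
(* Cutting [h] off outside the open interval makes it bounded and measurable everywhere, whatever
   its values at the endpoints; the integral is unaffected. *)
pose h0 := (h \_ `]0, L[)%classic.
have mh0 : measurable_fun setT h0.
  apply/(measurable_restrictT _ _).1 => //.
  apply: open_continuous_measurable_fun; first exact: interval_open.
  by move=> x; rewrite inE => /hc.
have C0 : 0 <= C.
  have L2 : L / 2 \in `]0, L[ by rewrite in_itv/=; apply/andP; split; lra.
  exact: le_trans (hC _ L2).
have h0C x : `|h0 x| <= C.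
  rewrite /h0 patchE; case: ifPn => [|_]; last by rewrite normr0.
  by rewrite inE; exact: hC.
have ih0 : mu.-integrable `[0, L]%classic (EFin \o h0).
  apply: measurable_bounded_integrable => //.
  - have := @lebesgue_measure_itv R `[0, L].
    by rewrite /= lte_fin L0 oppr0 adde0 => ->; rewrite ltry.
  - exact: measurable_funS mh0.
  - exists C; split; first exact: num_real.
    by move=> M CM x _; exact: le_trans (h0C x) (ltW CM).
pose G x := parameterized_integral mu 0 x h0.
have Gc : {within `[0, L], continuous G}
  by exact: parameterized_integral_continuous (ltW L0) ih0.
have Gd x : x \in `]0, L[ -> is_derive x 1 G (h x).
  move=> xL; have := xL; rewrite in_itv/= => /andP[x0 xltL].
  have hx : {for x, continuous h0}.
    rewrite /prop_for /continuous_at /h0 {2}/patch mem_set//.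
    apply: cvg_trans (hc x xL); apply: near_eq_cvg; near=> y.
    rewrite patchE mem_set//=.
    by near: y; exact: near_in_itvoo.
  have [d1 d2] := continuous_FTC1_closed xltL ih0 x0 hx.
  have <- : h0 x = h x by rewrite /h0 patchE mem_set.
  by rewrite -d2 derive1E; exact: derivableP.
exists G; split => //; last exact: lipschitz_itv_derive Gc Gd hC.
by rewrite /G /parameterized_integral set_itv1 Rintegral_set1.
Unshelve. all: by end_near. Qed.

Lemma within_continuousD (R : realType) (A : set R) (f g : R -> R) :
  {within A, continuous f} -> {within A, continuous g} ->
  {within A, continuous (fun t => f t + g t)}.
Proof. by move=> fc gc x; apply: cvgD; [exact: fc|exact: gc]. Qed.

Lemma within_continuousB (R : realType) (A : set R) (f g : R -> R) :
  {within A, continuous f} -> {within A, continuous g} ->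
  {within A, continuous (fun t => f t - g t)}.
Proof. by move=> fc gc x; apply: cvgB; [exact: fc|exact: gc]. Qed.

Lemma within_continuousM (R : realType) (A : set R) (f g : R -> R) :
  {within A, continuous f} -> {within A, continuous g} ->
  {within A, continuous (fun t => f t * g t)}.
Proof. by move=> fc gc x; apply: cvgM; [exact: fc|exact: gc]. Qed.

(** * Trigonometric inequalities *)

(** [G s / s] is the mean of the nondecreasing [p] over [0, s], so it is nondecreasing; the product
    form includes s = 0. The means over [0, s] and [s, t] are values [p c] and [p d] with c < d. *)
Lemma primitive_quotient_le (R : realType) (L : R) (G p : R -> R) :
  G 0 = 0 -> {within `[0, L], continuous G} ->
  (forall x, x \in `]0, L[ -> is_derive x 1 G (p x)) ->
  (forall x y, 0 < x -> x <= y -> y < L -> p x <= p y) ->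
  forall s t, 0 <= s -> s <= t -> t <= L -> G s * t <= G t * s.
Proof.
move=> G0 Gc Gp pmono s t.
rewrite le_eqVlt => /predU1P[<-|s0]; first by rewrite G0 mul0r mulr0.
rewrite le_eqVlt => /predU1P[->//|st] tL.
have [c [c0 cs Ec]] := mean_value Gc Gp (lexx 0) s0 (le_trans (ltW st) tL).
have [d [ds dt Ed]] := mean_value Gc Gp (ltW s0) st tL.
rewrite G0 !subr0 in Ec.
have cd : p c <= p d.
  by apply: pmono; rewrite ?(ltW (lt_trans cs ds))// (lt_le_trans dt tL).
have : p c * (s * (t - s)) <= p d * (s * (t - s)).
  by rewrite ler_wpM2r// mulr_ge0 ?subr_ge0// ltW.
rewrite mulrA -Ec mulrCA -Ed; lra.
Qed.

Lemma sin_dist_le (R : realType) (x y : R) : `|sin x - sin y| <= `|x - y|.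
Proof.
wlog yx : x y / y <= x.
  by move=> H; have [/H//|/ltW/H] := leP y x; rewrite distrC (distrC x).
rewrite [leRHS]ger0_norm ?subr_ge0// -[leRHS]mul1r.
apply: (@lipschitz_itv_derive _ 1 y x sin cos) => //.
- exact/continuous_subspaceT/continuous_sin.
- by move=> t _; exact: cos_max.
Qed.

Lemma cos_dist_le (R : realType) (x y : R) : `|cos x - cos y| <= `|x - y|.
Proof.
rewrite -!sinDpihalf (le_trans (sin_dist_le _ _))//.
by rewrite [_ - _](_ : _ = x - y)//; lra.
Qed.

Lemma sin_le_id (R : realType) (x : R) : 0 <= x -> sin x <= x.
Proof.
move=> x0; have := sin_dist_le x 0; rewrite sin0 !subr0 (ger0_norm x0).
exact: le_trans (ler_norm _).
Qed.

Lemma cos_ge_quadratic (R : realType) (x : R) : 1 - x ^+ 2 / 2 <= cos x.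
Proof.
have -> : x = (x / 2) *+ 2 by rewrite mulr2n; field.
rewrite cos_mulr2n cos2sin2.
have h : sin (x / 2) ^+ 2 <= (x / 2) ^+ 2.
  rewrite -[leLHS]real_normK ?num_real// -[leRHS]real_normK ?num_real//.
  rewrite lerXn2r ?nnegrE//.
  by have := sin_dist_le (x / 2) 0; rewrite sin0 !subr0.
rewrite -mulr_natr; move: h; rewrite -mulr_natr.
move: (sin _) (x / 2) => a b; nra.
Qed.

Lemma one_lt_pihalf (R : realType) : 1 < pi / 2 :> R.
Proof.
rewrite lt_neqAle pihalf_ge1 andbT; apply/eqP => h.
by have := @cos1_gt0 R; rewrite h cos_pihalf ltxx.
Qed.

Lemma cos_gt0_unit (R : realType) (x : R) : 0 <= x -> x <= 1 -> 0 < cos x.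
Proof.
move=> x0 x1; apply: cos_gt0_pihalf; have := one_lt_pihalf R; lra.
Qed.

Lemma sin_gt0_unit (R : realType) (x : R) : 0 < x -> x <= 1 -> 0 < sin x.
Proof.
move=> x0 x1; apply: sin_gt0_pihalf; have := one_lt_pihalf R; lra.
Qed.

Lemma id_le_tan (R : realType) (x : R) : 0 <= x -> x <= 1 -> x <= tan x.
Proof.
move=> x0 x1.
have c0 t : t \in `[0, x] -> cos t != 0.
  rewrite in_itv/= => /andP[t0 tx].
  by rewrite gt_eqF// cos_gt0_unit// (le_trans tx).
have Gc : {within `[0, x], continuous (fun t => tan t - t)}.
  apply: continuous_in_subspaceT => t; rewrite inE/= => tx.
  apply: continuousB; last exact: cvg_id.
  exact: continuous_tan (c0 _ tx).
have := @derive_ge0_le R 0 x (fun t => tan t - t) (fun t =>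
  (cos t) ^- 2 - 1) Gc.
move=> /(_ _ _ 0 x (lexx _) x0 (lexx _)); rewrite tan0 subrr subr_ge0; apply.
- move=> t tx; apply: is_derive1_sub.
  by apply: is_derive_tan; apply: c0; apply: subset_itv_oo_cc.
- move=> t tx.
  have ct : 0 < cos t.
    move: tx; rewrite in_itv/= => /andP[t0 tx].
    by rewrite cos_gt0_unit// ltW// (lt_le_trans tx).
  by rewrite cos2_tan2 ?gt_eqF// addrC addKr sqr_ge0.
Qed.

Lemma tan_quotient_le (R : realType) (x y : R) :
  0 <= x -> x <= y -> y <= 1 -> tan x * y <= tan y * x.
Proof.
move=> x0 xy y1.
have c0 t : t \in `[0, y] -> 0 < cos t.
  rewrite in_itv/= => /andP[t0 ty].
  by rewrite cos_gt0_unit// (le_trans ty).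
apply: (@primitive_quotient_le R y tan (fun t => (cos t) ^- 2)) => //.
- exact: tan0.
- apply: continuous_in_subspaceT => t; rewrite inE/= => ty.
  by apply: continuous_tan; rewrite gt_eqF// c0.
- move=> t ty; apply: is_derive_tan.
  by rewrite gt_eqF// c0//; apply: subset_itv_oo_cc.
- move=> s t s0 st ty.
  have cs : 0 < cos s by apply: c0;
    rewrite in_itv/= (ltW s0) (ltW (le_lt_trans st ty)).
  have ct : 0 < cos t by apply: c0;
    rewrite in_itv/= (ltW (lt_le_trans s0 st)) (ltW ty).
  rewrite lef_pV2 ?posrE ?exprn_gt0// lerXn2r ?nnegrE ?(ltW cs) ?(ltW ct)//.
  move: st; rewrite le_eqVlt => /predU1P[->//|st]; apply: ltW;
    rewrite ltr_cos//.
  all: rewrite in_itv/=; have := one_lt_pihalf R; lra.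
Qed.

Lemma sin_quotient_le (R : realType) (x y : R) :
  0 <= x -> x <= y -> y <= 1 -> sin y * x <= sin x * y.
Proof.
move=> x0 xy y1; rewrite -lerN2 -!mulNr.
apply: (@primitive_quotient_le R y (fun t => - sin t) (fun t => - cos t)) => //.
- by rewrite sin0 oppr0.
- apply: continuous_subspaceT => t; apply: continuousN.
  exact: continuous_sin.
- move=> s t s0 + ty; rewrite le_eqVlt => /predU1P[->//|st].
  rewrite lerN2; apply: ltW; rewrite ltr_cos//.
  all: rewrite in_itv/=; have := one_lt_pihalf R; lra.
Qed.

(** tan v / sin u is the product of tan v / v, v / u and u / sin u. The outer factors increase with
    v and u; the last hypothesis makes the middle one increase. *)
Lemma tan_div_sin_le (R : realType) (u1 v1 u2 v2 : R) :
  0 < u1 -> u1 <= u2 -> u2 <= 1 -> 0 < v1 -> v1 <= v2 -> v2 <= 1 ->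
  v1 * u2 <= v2 * u1 -> tan v1 / sin u1 <= tan v2 / sin u2.
Proof.
move=> u10 u12 u21 v10 v12 v21 uv.
have u20 := lt_le_trans u10 u12; have v20 := lt_le_trans v10 v12.
have s1 : 0 < sin u1 by apply: sin_gt0_unit; lra.
have s2 : 0 < sin u2 by apply: sin_gt0_unit.
have t2 : 0 < tan v2 by apply: (lt_le_trans v20); apply: id_le_tan; lra.
have A := tan_quotient_le (ltW v10) v12 v21.
have B := sin_quotient_le (ltW u10) u12 u21.
have t1 : 0 < tan v1.
  by apply: (lt_le_trans v10); apply: id_le_tan;
    [exact: ltW|exact: le_trans v21].
rewrite ler_pdivrMr// mulrAC ler_pdivlMr//.
rewrite -(ler_pM2r (mulr_gt0 v20 u10)).
have C : (tan v1 * v2) * (sin u2 * u1) <= (tan v2 * v1) * (sin u1 * u2).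
  by rewrite ler_pM// mulr_ge0// ltW.
have D : tan v2 * sin u1 * (v1 * u2) <= tan v2 * sin u1 * (v2 * u1).
  by rewrite ler_wpM2l// mulr_ge0// ltW.
have -> : tan v1 * sin u2 * (v2 * u1) = tan v1 * v2 * (sin u2 * u1) by ring.
apply: (le_trans C).
by have -> : tan v2 * v1 * (sin u1 * u2) = tan v2 * sin u1 * (v1 * u2) by ring.
Qed.

Lemma tan_div_sin_ge (R : realType) (a u v : R) :
  0 < u -> u <= 1 -> 0 <= v -> v <= 1 -> a * u <= v -> a <= tan v / sin u.
Proof.
move=> u0 u1 v0 v1 auv.
have s0 := sin_gt0_unit u0 u1.
have tv := id_le_tan v0 v1; have su := sin_le_id (ltW u0).
rewrite ler_pdivlMr//; have [a0|/ltW a0] := leP 0 a; last first.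
  by rewrite (le_trans (mulr_le0_ge0 a0 (ltW s0)))// (le_trans v0).
by apply: (le_trans (ler_wpM2l a0 su)); exact: le_trans tv.
Qed.

(** The quotient is at most (a + 3 s^2)(1 + s^2)^2, where one factor 1 + s^2 comes from tan v / v
    and the other from u / sin u. For a <= 1 and s^2 <= 1/3 this stays below a + 9 s^2, which is the
    derivative of the bound a s + 3 s^3 in [admissible]. *)
Lemma tan_div_sin_upper (R : realType) (a s u v : R) :
  0 <= a -> a <= 1 -> 0 < u -> u <= s -> s ^+ 2 <= 3^-1 ->
  0 <= v -> v <= u -> v <= (a + 3 * u ^+ 2) * u ->
  tan v / sin u <= a + 9 * s ^+ 2.
Proof.
move=> a0 a1 u0 us s3 v0 vu vau.
have s0 : 0 < s := lt_le_trans u0 us.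
have us2 : u ^+ 2 <= s ^+ 2 by rewrite lerXn2r ?nnegrE ?(ltW u0) ?(ltW s0).
have vu2 : v ^+ 2 <= u ^+ 2 by rewrite lerXn2r ?nnegrE// ltW.
have u1 : u <= 1.
  by rewrite leNgt; apply/negP => u1; move: us2 s3; rewrite [u ^+ 2]expr2; nra.
have v1 : v <= 1 := le_trans vu u1.
have su : 0 < sin u by exact: sin_gt0_unit.
have cu := cos_gt0_unit (ltW u0) u1; have cv := cos_gt0_unit v0 v1.
have A : u <= sin u * (1 + u ^+ 2).
  have h := id_le_tan (ltW u0) u1; rewrite /tan ler_pdivlMr// in h.
  have k := cos_ge_quadratic u.
  apply: (@le_trans _ _ (u * cos u * (1 + u ^+ 2))); last first.
    by rewrite ler_wpM2r// addr_ge0// sqr_ge0.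
  rewrite -mulrA ler_peMr ?(ltW u0)//.
  have : (1 - u ^+ 2 / 2) * (1 + u ^+ 2) <= cos u * (1 + u ^+ 2).
    by rewrite ler_wpM2r// addr_ge0// sqr_ge0.
  move=> e; apply: (le_trans _ e); have := sqr_ge0 u; move: (u ^+ 2) us2 =>
    w *; nra.
have B : tan v <= v * (1 + v ^+ 2).
  rewrite /tan ler_pdivrMr//; apply: (le_trans (sin_le_id v0)).
  rewrite -mulrA ler_peMr//; have k := cos_ge_quadratic v.
  have : (1 + v ^+ 2) * (1 - v ^+ 2 / 2) <= (1 + v ^+ 2) * cos v.
    by rewrite ler_wpM2l// addr_ge0// sqr_ge0.
  move=> e; apply: (le_trans _ e); have := sqr_ge0 v; move: (v ^+ 2) vu2 =>
    w *; nra.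
have q0 : 0 < 1 + s ^+ 2 by rewrite ltr_pwDl// sqr_ge0.
rewrite ler_pdivrMr//; apply: (le_trans B).
have s20 := sqr_ge0 s; have u20 := sqr_ge0 u; have v20 := sqr_ge0 v.
apply: (@le_trans _ _ ((a + 9 * s ^+ 2) / (1 + s ^+ 2) * u)); last first.
  rewrite -mulrA; apply: ler_wpM2l; first lra.
  rewrite ler_pdivrMl// mulrC; apply: (le_trans A).
  by apply: ler_wpM2l; [exact: ltW|rewrite lerD2l].
apply: (@le_trans _ _ ((a + 3 * s ^+ 2) * u * (1 + s ^+ 2))).
  apply: ler_pM => //; [lra| |by rewrite lerD2l (le_trans vu2)].
  by apply: (le_trans vau); apply: ler_wpM2r;
    [exact: ltW|rewrite lerD2l ler_wpM2l].
rewrite mulrAC; apply: ler_wpM2r; first exact: ltW.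
rewrite ler_pdivlMr//.
move: (s ^+ 2) s3 s20 => w w3 w0.
have w1 : w * w <= w / 3 by nra.
nra.
Qed.

(** * The functional equation *)

(* The second clause says that [f s / s] is nondecreasing. *)
Definition admissible (R : realType) (a L : R) (f : R -> R) :=
  [/\ forall s, 0 <= s -> s <= L -> a * s <= f s <= a * s + 3 * s ^+ 3,
      forall s t, 0 <= s -> s <= t -> t <= L -> f s * t <= f t * s &
      lipschitz_itv 1 0 L f].

Lemma admissible_gt0 (R : realType) (a L : R) (f : R -> R) : 0 < a ->
  admissible a L f -> forall s, 0 < s -> s <= L -> 0 < f s.
Proof.
move=> a0 [fb _ _] s s0 sL; have /andP[h _] := fb s (ltW s0) sL.
by apply: lt_le_trans h; exact: mulr_gt0.
Qed.

Lemma admissible0 (R : realType) (a L : R) (f : R -> R) : 0 < L ->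
  admissible a L f -> f 0 = 0.
Proof.
move=> L0 [fb _ _]; have := fb 0 (lexx _) (ltW L0).
by rewrite expr0n/= !mulr0 addr0 => /le_anti.
Qed.

Lemma admissible_le (R : realType) (a L : R) (f : R -> R) :
  a < 1 -> 9 * L ^+ 2 <= 1 - a -> admissible a L f ->
  forall s, 0 <= s -> s <= L -> f s <= s.
Proof.
move=> a1 aL [fb _ _] s s0 sL; have /andP[_] := fb s s0 sL.
move/le_trans; apply; have : s ^+ 2 <= L ^+ 2.
  by rewrite lerXn2r ?nnegrE// (le_trans s0).
rewrite (exprSr _ 2) => h.
have -> : a * s + 3 * (s ^+ 2 * s) = (a + 3 * s ^+ 2) * s by ring.
by apply: ler_piMl => //; have := sqr_ge0 L; lra.
Qed.

Lemma admissible_homo (R : realType) (a L : R) (f : R -> R) : 0 < a ->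
  admissible a L f ->
  forall s t, 0 <= s -> s <= t -> t <= L -> f s <= f t.
Proof.
move=> a0 fadm s t s0 + tL; rewrite le_eqVlt => /predU1P[->//|st].
have t0 : 0 < t := le_lt_trans s0 st.
have := admissible_gt0 a0 fadm t0 tL; case: fadm => _ fq _ ft.
have := fq s t s0 (ltW st) tL.
rewrite -ler_pdivlMr// => /le_trans; apply.
by rewrite ler_pdivrMr// ler_pM2l// ltW.
Qed.

Lemma admissible_lt (R : realType) (a L : R) (f : R -> R) : 0 < a ->
  admissible a L f -> forall s t, 0 <= s -> s < t -> t <= L -> f s < f t.
Proof.
move=> a0 fadm s t s0 st tL; have t0 := le_lt_trans s0 st.
have := admissible_gt0 a0 fadm t0 tL; case: fadm => _ fq _ ft.
have h := fq s t s0 (ltW st) tL.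
rewrite -(ltr_pM2r t0); apply: (le_lt_trans h).
by rewrite ltr_pM2l.
Qed.

Definition involute_rate (R : realType) (f : R -> R) s :=
  tan (f (f s)) / sin (f s).

Section functional_equation.
Context {R : realType}.
Variables a L : R.
Hypotheses (a0 : 0 < a) (a1 : a < 1) (L0 : 0 < L) (aL : 9 * L ^+ 2 <= 1 - a).
Implicit Types f G : R -> R.

Let L1 : L <= 1.
Proof.
rewrite leNgt; apply/negP => L1; move: aL a0; rewrite expr2 => h1 h2.
by have : 1 < L * L; [rewrite -[ltLHS]mulr1 ltr_pM|lra].
Qed.

Let L3 : L ^+ 2 <= 3^-1. Proof. move: aL a0; lra. Qed.

Let P := @involute_rate R.

Lemma admissible_comp f s : admissible a L f -> 0 < s -> s <= L ->
  [/\ 0 < f s, f s <= s, 0 < f (f s) & f (f s) <= f s].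
Proof.
move=> fa s0 sL.
have f0 := admissible_gt0 a0 fa s0 sL.
have fs := admissible_le a1 aL fa (ltW s0) sL.
split=> //; first by apply: (admissible_gt0 a0 fa) => //; exact: le_trans sL.
by apply: (admissible_le a1 aL fa); [exact: ltW|exact: le_trans sL].
Qed.

(** The quotient condition at the points f s <= f t supplies the comparison of f (f s) / f s with f
    (f t) / f t. The result returns the quotient condition for the primitive of [P f]. *)
Lemma rate_homo f s t : admissible a L f -> 0 < s -> s <= t -> t <= L ->
  P f s <= P f t.
Proof.
move=> fa s0 st tL.
have t0 := lt_le_trans s0 st; have sL := le_trans st tL.
have [fs0 fss ffs0 ffs] := admissible_comp fa s0 sL.
have [ft0 ftt fft0 fft] := admissible_comp fa t0 tL.
have fst := admissible_homo a0 fa (ltW s0) st tL.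
have ftL := le_trans ftt tL.
apply: tan_div_sin_le => //.
- exact: le_trans ftL L1.
- exact: (admissible_homo a0 fa (ltW fs0) fst).
- exact: le_trans (le_trans fft ftL) L1.
- by case: fa => _ fq _; exact: (fq _ _ (ltW fs0)).
Qed.

(** Monotonicity of the operator, although f also stands in the denominator: f1 (f1 s) / f1 s <= f1
    (f2 s) / f2 s because f1 has nondecreasing quotient, and this is at most f2 (f2 s) / f2 s. *)
Lemma rate_le f1 f2 s : admissible a L f1 -> admissible a L f2 ->
  (forall t, 0 <= t -> t <= L -> f1 t <= f2 t) ->
  0 < s -> s <= L -> P f1 s <= P f2 s.
Proof.
move=> fa1 fa2 f12 s0 sL.
have [fs0 fss ffs0 ffs] := admissible_comp fa1 s0 sL.
have [ft0 ftt fft0 fft] := admissible_comp fa2 s0 sL.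
have f2L := le_trans ftt sL.
have fst := f12 s (ltW s0) sL.
have h := f12 _ (ltW ft0) f2L.
apply: tan_div_sin_le => //.
- exact: le_trans f2L L1.
- by apply: (le_trans _ h); exact: (admissible_homo a0 fa1 (ltW fs0)).
- exact: le_trans (le_trans fft f2L) L1.
- case: fa1 => _ fq _; apply: (le_trans (fq _ _ (ltW fs0) fst f2L)).
  by rewrite ler_wpM2r// ltW.
Qed.

Lemma rate_bounds f s : admissible a L f -> 0 < s -> s <= L ->
  a <= P f s <= a + 9 * s ^+ 2.
Proof.
move=> fa s0 sL; have [fs0 fss ffs0 ffs] := admissible_comp fa s0 sL.
have fL := le_trans fss sL; have f1 := le_trans fL L1.
case: fa => fb _ _; have /andP[lo up] := fb _ (ltW fs0) fL.
apply/andP; split.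
  by apply: tan_div_sin_ge => //; [exact: ltW|exact: le_trans f1].
apply: tan_div_sin_upper => //.
- exact: ltW.
- exact: ltW.
- by apply: le_trans L3; rewrite lerXn2r ?nnegrE ?(ltW s0) ?(ltW L0).
- exact: ltW.
- apply: (le_trans up); move: (f s) => u.
  by have -> : (a + 3 * u ^+ 2) * u = a * u + 3 * u ^+ 3 by ring.
Qed.

(** The admissible class is invariant: a <= [P f] <= a + 9 s^2 integrates to the two bounds of the
    class, and 9 L^2 <= 1 - a keeps the rate below 1, hence the Lipschitz constant 1. *)
Lemma rate_primitive f : admissible a L f -> exists G,
  [/\ admissible a L G & forall x, x \in `]0, L[ -> is_derive x 1 G (P f x)].
Proof.
move=> fa; have [fb fq fl] := fa.
have Pb x : x \in `]0, L[ -> a <= P f x <= a + 9 * x ^+ 2.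
  by rewrite in_itv/= => /andP[x0 xL]; apply: rate_bounds => //; exact: ltW.
have P1 x : x \in `]0, L[ -> `|P f x| <= 1.
  move=> xL; have /andP[lo up] := Pb _ xL.
  rewrite ger0_norm ?(le_trans (ltW a0))//; apply: (le_trans up).
  have : x ^+ 2 <= L ^+ 2; last by move: aL a0; lra.
  move: xL; rewrite in_itv/= => /andP[x0 xL].
  by rewrite lerXn2r ?nnegrE ?(ltW x0) ?(ltW L0) ?ltW.
have fc : {in `]0, L[, continuous f}.
  move=> x xL; apply: (within_continuous_continuous L0 _ xL).
  exact: lipschitz_itv_continuous fl.
have Pc : {in `]0, L[, continuous (P f)}.
  move=> x xL; have := xL; rewrite in_itv/= => /andP[x0 xltL].
  have [fx0 fxx ffx0 ffx] := admissible_comp fa x0 (ltW xltL).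
  have fxL : f x \in `]0, L[ by rewrite in_itv/= fx0 (le_lt_trans fxx).
  have f1 : f x <= 1 by rewrite (le_trans _ L1)// (le_trans fxx)// ltW.
  apply: (@continuousM _ _ (fun s => tan (f (f s))) (fun s => (sin (f s))^-1)).
  - apply: (@continuous_comp _ _ _ (f \o f) tan).
      by apply: continuous_comp; [exact: fc|exact: fc].
    apply: continuous_tan; rewrite gt_eqF// cos_gt0_unit// ?(ltW ffx0)//.
    exact: le_trans f1.
  - apply: continuousV; first by rewrite gt_eqF// sin_gt0_unit.
    apply: (@continuous_comp _ _ _ f sin); first exact: fc.
    exact: continuous_sin.
have [G [G0 Gl Gd]] := primitive_bounded L0 Pc P1.
have Gc := lipschitz_itv_continuous Gl.
exists G; split=> //; split=> //.
- move=> s s0 sL.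
  have h1 : {within `[0, L], continuous (fun t => G t - a * t)}.
    by apply: within_continuousB Gc _;
      exact/continuous_subspaceT/mulrl_continuous.
  have h2 : {within `[0, L], continuous (fun t => a * t + 3 * t ^+ 3 - G t)}.
    apply: within_continuousB Gc; apply: within_continuousD.
      exact/continuous_subspaceT/mulrl_continuous.
    apply: within_continuousM; first exact/continuous_subspaceT/cst_continuous.
    exact/continuous_subspaceT/exprn_continuous.
  have d1 t : t \in `]0, L[ -> is_derive t 1 (fun t =>
    G t - a * t) (P f t - a * 1).
    by move=> /Gd h; apply: is_derive1_sub => //;
      exact: (@is_derive1_scale _ id).
  have d2 t : t \in `]0, L[ ->
      is_derive t 1 (fun t => a * t + 3 * t ^+ 3 - G t)
        (a * 1 + 3 * (3%:R * t ^+ 2 * 1) - P f t).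
    move=> /Gd h; apply: is_derive1_sub => //; apply: is_derive1_add.
    apply: is_derive1_scale.
    exact: (@is_deriveX R R id 3 t 1 1 (is_derive_id t 1)).
  have := derive_ge0_le h1 d1 _ (lexx 0) s0 sL.
  have := derive_ge0_le h2 d2 _ (lexx 0) s0 sL.
  rewrite expr0n/= !mulr0 !addr0 G0 !subr0 !subr_ge0 => -> //;
    first move=> -> //.
    by move=> t /Pb /andP[? ?]; lra.
  by move=> t /Pb /andP[? ?]; lra.
- apply: primitive_quotient_le Gc Gd _ => // x y x0 xy yL.
  exact: rate_homo (ltW yL).
Qed.

Let rate_primitive_le f1 f2 G1 G2 : admissible a L f1 -> admissible a L f2 ->
  (forall t, 0 <= t -> t <= L -> f1 t <= f2 t) ->
  admissible a L G1 -> admissible a L G2 ->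
  (forall x, x \in `]0, L[ -> is_derive x 1 G1 (P f1 x)) ->
  (forall x, x \in `]0, L[ -> is_derive x 1 G2 (P f2 x)) ->
  forall t, 0 <= t -> t <= L -> G1 t <= G2 t.
Proof.
move=> fa1 fa2 f12 Ga1 Ga2 Gd1 Gd2 t t0 tL.
have [[_ _ Gl1] [_ _ Gl2]] := (Ga1, Ga2).
have := @derive_ge0_le R 0 L (fun t => G2 t - G1 t) (fun t => P f2 t - P f1 t).
move=> /(_ _ _ _ 0 t (lexx 0) t0 tL).
rewrite (admissible0 L0 Ga1) (admissible0 L0 Ga2) subrr subr_ge0; apply.
- by apply: within_continuousB; apply: lipschitz_itv_continuous; eassumption.
- by move=> x xL; apply: is_derive1_sub; [exact: Gd2|exact: Gd1].
- move=> x; rewrite in_itv/= => /andP[x0 xL].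
  by rewrite subr_ge0 rate_le// ltW.
Qed.

(* Knaster-Tarski: the pointwise supremum of the subsolutions is a solution,
   because [f |-> \int_0^s P f] is monotone on admissible functions. *)
Theorem involute_rate_solution : exists f, admissible a L f /\
  forall s, s \in `]0, L[ -> is_derive s 1 f (P f s).
Proof.
pose sub f := admissible a L f /\ exists2 G, admissible a L G &
  (forall x, x \in `]0, L[ -> is_derive x 1 G (P f x)) /\
  (forall t, 0 <= t -> t <= L -> f t <= G t).
(* The line of slope a is the least admissible function, so it lies below its image. *)
have lin : sub (fun s => a * s).
  have adm : admissible a L (fun s => a * s).
    split.
    - by move=> s s0 _; rewrite lexx lerDl mulr_ge0// exprn_ge0.
    - by move=> s t _ _ _; rewrite mulrAC.
    - move=> s t _ st _;
        rewrite -mulrBr normrM gtr0_norm// ger0_norm ?subr_ge0//.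
      by rewrite ler_wpM2r ?subr_ge0// ltW.
  split=> //; have [G [Ga Gd]] := rate_primitive adm.
  by exists G => //; split=> // t t0 tL; case: Ga => /(_ t t0 tL)/andP[].
pose S s := [set f s | f in sub].
pose F s := sup (S s).
have supS s : 0 <= s -> s <= L -> has_sup (S s).
  move=> s0 sL; split; first by exists (a * s), (fun s => a * s).
  exists (a * s + 3 * s ^+ 3) => _ [f [[fb _ _] _] <-].
  by have /andP[] := fb s s0 sL.
have leF f s : sub f -> 0 <= s -> s <= L -> f s <= F s.
  move=> fs s0 sL; apply: ub_le_sup; last by exists f.
  by have [] := supS s s0 sL.
have Fle s y : 0 <= s -> s <= L -> (forall f, sub f -> f s <= y) -> F s <= y.
  move=> s0 sL H; apply: ge_sup; first by have [] := supS s s0 sL.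
  by move=> _ [f fs <-]; exact: H.
(* Each clause of [admissible] is a family of inequalities that survives a pointwise supremum. *)
have Fa : admissible a L F.
  split.
  - move=> s s0 sL; rewrite leF//=; apply: Fle => // f [[fb _ _] _].
    by have /andP[] := fb s s0 sL.
  - move=> s t + + tL; rewrite le_eqVlt => /predU1P[<-|s0] st.
      rewrite mulr0; apply: mulr_le0_ge0 => //.
      apply: Fle (lexx 0) (ltW L0) _ => f [[fb _ _] _].
      by have := fb 0 (lexx _) (ltW L0); rewrite expr0n/= !mulr0 addr0 =>
        /andP[].
    have t0 := lt_le_trans s0 st.
    rewrite -ler_pdivlMr//; apply: Fle; [exact: ltW|exact: le_trans tL|].
    move=> f fs; rewrite ler_pdivlMr//.
    have [[_ fq _] _] := fs; apply: (le_trans (fq s t (ltW s0) st tL)).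
    by apply: ler_wpM2r; [exact: ltW|apply: leF => //; exact: ltW].
  - move=> s t s0 st tL; have t0 := le_trans s0 st; have sL := le_trans st tL.
    rewrite mul1r ler_norml; apply/andP; split.
      rewrite lerBrDr addrC -lerBrDr opprK; apply: Fle => // f fs.
      have [[_ _ fl] _] := fs; have := fl s t s0 st tL.
      rewrite mul1r ler_norml => /andP[h _]; have := leF f t fs t0 tL; lra.
    rewrite lerBlDr; apply: Fle => // f fs.
    have [[_ _ fl] _] := fs; have := fl s t s0 st tL.
    rewrite mul1r ler_norml => /andP[_ h]; have := leF f s fs s0 sL; lra.
have [G [Ga Gd]] := rate_primitive Fa.
have FG t : 0 <= t -> t <= L -> F t <= G t.
  move=> t0 tL; apply: Fle => // f fs; have [fa [H Ha [Hd fH]]] := fs.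
  apply: (le_trans (fH t t0 tL)).
  by apply: (rate_primitive_le fa Fa _ Ha Ga Hd Gd) => // u u0 uL; exact: leF.
(* The image G of F lies above F, so by monotonicity it is again a subsolution and hence lies below
   the supremum F. *)
have Gs : sub G.
  split=> //; have [H [Ha Hd]] := rate_primitive Ga; exists H => //; split=> //.
  exact: (rate_primitive_le Fa Ga FG Ga Ha Gd Hd).
have FE t : t \in `]0, L[ -> G t = F t.
  rewrite in_itv/= => /andP[/ltW t0 /ltW tL].
  by apply/le_anti; rewrite leF// FG.
exists F; split=> // s sL; apply: (is_derive1_eq_itv sL FE); exact: Gd.
Qed.

End functional_equation.

(** * The angle of the tangent *)

Lemma exists_mul_ln (R : realType) (M : R) : 0 < M ->
  exists b : R, 1 < b /\ b * ln b = M.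
Proof.
move=> M0.
have e1 : 1 <= expR M by rewrite -expR0 ler_expR ltW.
have c : {within `[1, expR M], continuous (fun x : R => x * ln x)}.
  apply: continuous_in_subspaceT => x; rewrite inE/= in_itv/= => /andP[x1 _].
  apply: continuousM; first exact: cvg_id.
  by apply: continuous_ln; exact: lt_le_trans x1.
have [|b bI Eb] := IVT e1 c (v := M).
  rewrite ln1 mulr0 expRK ge_min le_max (ltW M0)/=; apply/orP; right.
  by rewrite ler_peMl ?(ltW M0).
exists b; split=> //; move: bI; rewrite in_itv/= => /andP[+ _].
rewrite le_eqVlt => /predU1P[b1|b1]; last exact: b1.
by move: M0; rewrite -Eb -b1 ln1 mulr0 !ltxx.
Qed.

Lemma cot_bounds (R : realType) (u : R) : 0 < u -> u <= 1 ->
  u^-1 - u <= cos u / sin u <= u^-1.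
Proof.
move=> u0 u1; have s0 := sin_gt0_unit u0 u1; have c0 :=
  cos_gt0_unit (ltW u0) u1.
have h := id_le_tan (ltW u0) u1; rewrite /tan ler_pdivlMr// in h.
have k := cos_ge_quadratic u; have l := sin_le_id (ltW u0).
apply/andP; split; last by rewrite ler_pdivrMr// ler_pdivlMl.
rewrite ler_pdivlMr//.
have -> : u^-1 - u = (1 - u ^+ 2) / u by field; rewrite gt_eqF.
rewrite mulrAC ler_pdivrMr//.
have : (1 - u ^+ 2) * sin u <= (1 - u ^+ 2) * u.
  by rewrite ler_wpM2l// subr_ge0 expr_le1// ltW.
move/le_trans; apply; rewrite ler_wpM2r ?(ltW u0)//.
by apply: le_trans k; have := sqr_ge0 u; lra.
Qed.

Section tangent_angle.
Context {R : realType}.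
Variables (a L : R) (f : R -> R).
Hypotheses (a0 : 0 < a) (a1 : a < 1) (L0 : 0 < L) (aL : 9 * L ^+ 2 <= 1 - a).
Hypothesis fa : admissible a L f.

Let L1 : L <= 1.
Proof.
rewrite leNgt; apply/negP => L1; move: aL a0; rewrite expr2 => h1 h2.
by have : 1 < L * L; [rewrite -[ltLHS]mulr1 ltr_pM|lra].
Qed.

Let cot (u : R) : R := cos u / sin u.

(** Isolates the whole singularity of the curvature at 0. The 1 bounds the difference of cot (f u)
    and 1 / f u; the 3 / a^2 bounds that of 1 / f u and 1 / (a u), from the cubic error of f. *)
Let cot_f_bound u : 0 < u -> u < L ->
  `|cot (f u) - a^-1 * u^-1| <= 1 + 3 * a^-1 ^+ 2.
Proof.
move=> u0 /ltW uL; have fu0 := admissible_gt0 a0 fa u0 uL.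
have fu := admissible_le a1 aL fa (ltW u0) uL.
have u1 := le_trans uL L1; have fu1 := le_trans fu u1.
have [fb _ _] := fa; have /andP[lo up] := fb u (ltW u0) uL.
have /andP[] := cot_bounds fu0 fu1; rewrite -/(cot _).
move: (cot _) => c clo cup.
have b0 : 0 < a^-1 by rewrite invr_gt0.
have i1 : (f u)^-1 <= a^-1 * u^-1.
  by rewrite -invfM lef_pV2 ?posrE// mulr_gt0.
have i2 : a^-1 * u^-1 - 3 * a^-1 ^+ 2 <= (f u)^-1.
  rewrite -[leRHS]mul1r ler_pdivlMr//.
  have [h|/ltW h] := leP (a^-1 * u^-1 - 3 * a^-1 ^+ 2) 0.
    by apply: le_trans ler01; exact: mulr_le0_ge0 (ltW fu0).
  apply: (le_trans (ler_wpM2l h up)).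
  have -> : (a^-1 * u^-1 - 3 * a^-1 ^+ 2) * (a * u + 3 * u ^+ 3) =
    1 - 3 * a^-1 * u * (1 - u) - 9 * a^-1 ^+ 2 * u ^+ 3.
    by field; rewrite !gt_eqF.
  have A0 : 0 <= 3 * a^-1 * u * (1 - u).
    by rewrite !mulr_ge0 ?subr_ge0 ?(ltW b0) ?(ltW u0).
  have B0 : 0 <= 9 * a^-1 ^+ 2 * u ^+ 3.
    by rewrite !mulr_ge0 ?exprn_ge0 ?(ltW b0) ?(ltW u0).
  lra.
have b2 := sqr_ge0 a^-1.
by rewrite ler_norml; apply/andP; split; lra.
Qed.

(** The angle is [a^-1 * ln s] plus the primitive [om] of a bounded function. Between f s and s the
    logarithm contributes [a^-1 * ln a^-1] up to the deviation of f s / (a s) from 1, and [om]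
    changes by O(s). *)
Lemma exists_tangent_angle : exists Theta : R -> R,
  (forall s, s \in `]0, L[ -> is_derive s 1 Theta (cos (f s) / sin (f s))) /\
  exists C, forall s, 0 < s -> s < L ->
    `|Theta s - Theta (f s) - a^-1 * ln a^-1| <= C * s.
Proof.
pose w u := cot (f u) - a^-1 * u^-1.
have b0 : 0 < a^-1 by rewrite invr_gt0.
have wb u : u \in `]0, L[ -> `|w u| <= 1 + 3 * a^-1 ^+ 2.
  by rewrite in_itv/= => /andP[? ?]; exact: cot_f_bound.
have wc : {in `]0, L[, continuous w}.
  move=> x xL; have := xL; rewrite in_itv/= => /andP[x0 xltL].
  have fx0 := admissible_gt0 a0 fa x0 (ltW xltL).
  have fx := admissible_le a1 aL fa (ltW x0) (ltW xltL).
  have fx1 : f x <= 1 by rewrite (le_trans fx)// (le_trans (ltW xltL)).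
  have fcx : {for x, continuous f}.
    have [_ _ fl] := fa; apply: (within_continuous_continuous L0 _ xL).
    exact: lipschitz_itv_continuous fl.
  apply: cvgB; apply: cvgM.
  - by apply: (@continuous_comp _ _ _ f cos) => //; exact: continuous_cos.
  - apply: cvgV; first by rewrite gt_eqF// sin_gt0_unit.
    by apply: (@continuous_comp _ _ _ f sin) => //; exact: continuous_sin.
  - exact: cvg_cst.
  - by apply: cvgV; [rewrite gt_eqF|exact: cvg_id].
have [om [om0 oml omd]] := primitive_bounded L0 wc wb.
exists (fun s => a^-1 * ln s + om s); split.
  move=> s sL; have := sL; rewrite in_itv/= => /andP[s0 _].
  have -> : cos (f s) / sin (f s) = a^-1 * s^-1 + w s by rewrite /w /cot; ring.
  apply: is_derive1_add; last exact: omd.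
  by apply: is_derive1_scale; exact: is_derive1_ln.
exists (3 * a^-1 ^+ 2 + (1 + 3 * a^-1 ^+ 2)) => s s0 sL.
have fs0 := admissible_gt0 a0 fa s0 (ltW sL).
have fs := admissible_le a1 aL fa (ltW s0) (ltW sL).
have [fb _ _] := fa; have /andP[lo up] := fb s (ltW s0) (ltW sL).
have as0 : 0 < a * s by exact: mulr_gt0.
(* r measures the deviation of f from its tangent line at 0: 0 <= ln r <= r - 1 = O(s). *)
pose r := f s / (a * s).
have r0 : 0 < r by rewrite divr_gt0.
have r1 : 1 <= r by rewrite ler_pdivlMr// mul1r.
have r2 : r - 1 <= 3 * a^-1 * s.
  rewrite lerBlDr ler_pdivrMr//; apply: (le_trans up).
  have -> : (3 * a^-1 * s + 1) * (a * s) = a * s + 3 * s ^+ 2 by field;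
    rewrite gt_eqF.
  rewrite lerD2l ler_wpM2l// exprS ler_piMl ?sqr_ge0//.
  by rewrite (le_trans (ltW sL)).
have lnr0 : 0 <= ln r by exact: ln_ge0.
have lnr : ln r <= r - 1.
  by have := @le_ln1Dx R (r - 1); rewrite subrKC; apply; rewrite ltrBDr; lra.
have Ef : ln (f s) = ln r - ln a^-1 + ln s.
  have -> : f s = r * a * s by rewrite -mulrA divfK// gt_eqF.
  rewrite [ln a^-1]lnV ?posrE// opprK.
  by rewrite lnM ?posrE ?(mulr_gt0 r0 a0)// (@lnM _ r a) ?posrE.
have -> : a^-1 * ln s + om s - (a^-1 * ln (f s) + om (f s)) - a^-1 * ln a^-1
  = (om s - om (f s)) - a^-1 * ln r by rewrite Ef; ring.
have o1 := oml _ _ (ltW fs0) fs (ltW sL).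
have o2 : (1 + 3 * a^-1 ^+ 2) * (s - f s) <= (1 + 3 * a^-1 ^+ 2) * s.
  rewrite ler_wpM2l; [|by rewrite addr_ge0// mulr_ge0// sqr_ge0|].
    by [].
  by rewrite gerBl ltW.
apply: (le_trans (ler_normB _ _)).
have h1 : `|om s - om (f s)| <= (1 + 3 * a^-1 ^+ 2) * s := le_trans o1 o2.
have h2 : `|a^-1 * ln r| <= 3 * a^-1 ^+ 2 * s.
  rewrite ger0_norm; last by rewrite mulr_ge0// ltW.
  have -> : 3 * a^-1 ^+ 2 * s = a^-1 * (3 * a^-1 * s) by ring.
  by rewrite ler_wpM2l ?(ltW b0)// (le_trans lnr).
lra.
Qed.

End tangent_angle.

(** * Linear differential equations *)

(** Passage to the limit for errors that halve: Picard iterates, bisected chords, and parameters t /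
    2^n tending to 0. *)
Lemma ler_add_geometric (R : realType) (x y C : R) : 0 <= C ->
  (forall n : nat, x <= y + C / 2 ^+ n) -> x <= y.
Proof.
move=> C0 h; rewrite leNgt; apply/negP => yx.
have d0 : 0 < x - y by rewrite subr_gt0.
pose n := Num.Def.archi_bound (C / (x - y)).
have hn : C / (x - y) < n%:R by apply: archi_boundP; rewrite divr_ge0// ltW.
have n2 : n%:R <= 2 ^+ n :> R by rewrite -natrX ler_nat ltnW// ltn_expl.
have p0 : 0 < 2 ^+ n :> R by rewrite exprn_gt0.
have := h n; apply/negP; rewrite -ltNge -ltrBrDl ltr_pdivrMr//.
rewrite ltr_pdivrMr// in hn; apply: (lt_le_trans hn).
by rewrite mulrC ler_wpM2l// ltW.
Qed.

(** The radius 2 C / 2^n is the sum of all increment bounds from n on, so the intervals around [u n]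
    with this radius are nested; the limit is the supremum of their left ends. *)
Lemma geometric_increments_limit (R : realType) (C : R) (u : nat -> R) :
  (forall n, `|u n.+1 - u n| <= C / 2 ^+ n) ->
  exists l, forall n, `|u n - l| <= 2 * C / 2 ^+ n.
Proof.
move=> uC; pose lo n := u n - 2 * C / 2 ^+ n; pose hi n := u n + 2 * C / 2 ^+ n.
have half n : 2 * C / 2 ^+ n.+1 = C / 2 ^+ n :> R.
  by rewrite exprS; field; rewrite expf_neq0.
have dbl n : 2 * C / 2 ^+ n = C / 2 ^+ n + C / 2 ^+ n by ring.
have loS n : lo n <= lo n.+1.
  by rewrite /lo half dbl; have := uC n; rewrite ler_norml => /andP[]; lra.
have hiS n : hi n.+1 <= hi n.
  by rewrite /hi half dbl; have := uC n; rewrite ler_norml => /andP[]; lra.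
have loM : {homo lo : m n / (m <= n)%N >-> m <= n}.
  by apply: homo_leq => //; exact: le_trans.
have hiM : {homo hi : m n / (m <= n)%N >-> n <= m}.
  by apply: homo_leq => // x y z h1 h2; exact: le_trans h2 h1.
have C0 : 0 <= C.
  by have := uC 0%N; rewrite expr0 divr1; apply: le_trans.
have lohi m n : lo m <= hi n.
  apply: (@le_trans _ _ (lo (maxn m n))); first by apply: loM; exact: leq_maxl.
  apply: (@le_trans _ _ (hi (maxn m n))); last by apply: hiM; exact: leq_maxr.
  have : 0 <= 2 * C / 2 ^+ maxn m n by rewrite !mulr_ge0// invr_ge0 exprn_ge0.
  by rewrite /lo /hi; lra.
exists (sup (range lo)) => n.
have h1 : lo n <= sup (range lo).
  apply: ub_le_sup; last by exists n.
  by exists (hi 0%N) => _ [m _ <-].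
have h2 : sup (range lo) <= hi n.
  by apply: ge_sup; [exists (lo 0%N), 0%N|move=> _ [m _ <-]].
by move: h1 h2; rewrite /lo /hi ler_norml => h1 h2; apply/andP; split; lra.
Qed.

Lemma continuous_sum_pt (R : realType) (n : nat) (F : 'I_n -> R -> R) (x : R) :
  (forall i, {for x, continuous (F i)}) ->
  {for x, continuous (fun t => \sum_i F i t)}.
Proof.
move=> h; elim: (index_enum _) => [|i r IH].
  rewrite (_ : (fun t => _) = cst 0); first exact: cvg_cst.
  by apply/funext => t; rewrite big_nil.
rewrite (_ : (fun t => _) = (fun t => F i t + \sum_(j <- r) F j t)).
  by apply: cvgD; [exact: h|exact: IH].
by apply/funext => t; rewrite big_cons.
Qed.

Lemma norm_sum_ord_le (R : realType) (n : nat) (F : 'I_n -> R) (d : R) :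
  (forall i, `|F i| <= d) -> `|\sum_i F i| <= n%:R * d.
Proof.
move=> h; apply: (le_trans (ler_norm_sum _ _ _)).
apply: (@le_trans _ _ (\sum_(i < n) d)); first by apply: ler_sum => i _.
by rewrite sumr_const card_ord mulr_natl.
Qed.

(** Picard iteration. The bound n L <= 1/2 keeps the iterates below 2 m and makes each step halve
    distances. Each iterate is a primitive, so coefficients that are bounded and continuous inside
    suffice, with no limit at the endpoints. *)
Lemma linear_ode (R : realType) (n : nat) (L : R) (A : 'I_n -> 'I_n -> R -> R)
    (x0 : 'I_n -> R) :
  0 < L -> n%:R * L <= 2^-1 ->
  (forall i k, {in `]0, L[, continuous (A i k)}) ->
  (forall i k t, t \in `]0, L[ -> `|A i k t| <= 1) ->
  exists (K : R) (x : 'I_n -> R -> R),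
    [/\ forall i, x i 0 = x0 i, forall i, lipschitz_itv K 0 L (x i) &
        forall i t, t \in `]0, L[ ->
          is_derive t 1 (x i) (\sum_k A i k t * x k t)].
Proof.
move=> L0 nL Ac A1.
pose m := \sum_i `|x0 i|.
have m0 : 0 <= m by apply: sumr_ge0.
have x0m i : `|x0 i| <= m by rewrite /m (bigD1 i)//= lerDl sumr_ge0.
pose K := n%:R * (2 * m).
have K0 : 0 <= K by rewrite !mulr_ge0.
pose rhs (p : 'I_n -> R -> R) i t := \sum_k A i k t * p k t.
pose ok (p : 'I_n -> R -> R) := forall i, lipschitz_itv K 0 L (p i) /\
  forall t, 0 <= t -> t <= L -> `|p i t| <= 2 * m.
pose isnext (p q : 'I_n -> R -> R) := forall i, [/\ q i 0 = x0 i,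
  lipschitz_itv K 0 L (q i) & forall t, t \in `]0, L[ ->
    is_derive t 1 (q i) (rhs p i t)].
have rhs_diff (p q : 'I_n -> R -> R) d i t : t \in `]0, L[ ->
    (forall k, `|p k t - q k t| <= d) -> `|rhs p i t - rhs q i t| <= n%:R * d.
  move=> tL pq; rewrite /rhs -sumrB; apply: norm_sum_ord_le => k.
  rewrite -mulrBr normrM -[leRHS]mul1r.
  by apply: ler_pM => //; exact: A1.
have rhs_bound p i t : t \in `]0, L[ -> ok p -> `|rhs p i t| <= K.
  move=> tL okp; apply: norm_sum_ord_le => k.
  rewrite normrM -[leRHS]mul1r; apply: ler_pM => //; first exact: A1.
  by move: tL; rewrite in_itv/= => /andP[/ltW t0 /ltW tL]; exact: (okp k).2.
have rhs_cont p i : ok p -> {in `]0, L[, continuous (rhs p i)}.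
  move=> okp t tL; apply: continuous_sum_pt => k; apply: cvgM; first exact: Ac.
  apply: (within_continuous_continuous L0 _ tL).
  exact: lipschitz_itv_continuous (okp k).1.
have next p : ok p -> exists q, isnext p q /\ ok q.
  move=> okp.
  have H i : exists G, [/\ G 0 = 0, lipschitz_itv K 0 L G &
      forall t, t \in `]0, L[ -> is_derive t 1 G (rhs p i t)].
    by apply: primitive_bounded => // [|t tL];
      [exact: rhs_cont|exact: rhs_bound].
  have [G HG] := choice H.
  have Gl i : lipschitz_itv K 0 L (fun t => x0 i + G i t).
    have [_ Gl _] := HG i; move=> s t s0 st tL.
    by rewrite opprD addrACA subrr add0r; exact: Gl.
  exists (fun i t => x0 i + G i t); split=> i.
    have [G0 _ Gd] := HG i; split=> //; first by rewrite G0 addr0.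
    move=> t tL; rewrite -[rhs _ _ _]add0r; apply: is_derive1_add;
      last exact: Gd.
  split=> // t t0 tL; have [G0 Gli _] := HG i.
  have := Gli 0 t (lexx 0) t0 tL; rewrite G0 !subr0 => h.
  apply: (le_trans (ler_normD _ _)); rewrite mulr_natl mulr2n lerD//.
  apply: (le_trans h); apply: (@le_trans _ _ (K * L)); first
    by rewrite ler_wpM2l.
  rewrite (_ : K * L = (n%:R * L) * (2 * m)); last by rewrite /K; ring.
  apply: (@le_trans _ _ (2^-1 * (2 * m))); first
    by rewrite ler_wpM2r// mulr_ge0.
  by rewrite mulKf.
have contract p q p' q' d : 0 <= d -> ok p -> ok q -> isnext p p' ->
  isnext q q' ->
    (forall i t, 0 <= t -> t <= L -> `|p i t - q i t| <= d) ->
    forall i t, 0 <= t -> t <= L -> `|p' i t - q' i t| <= d / 2.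
  move=> d0 okp okq np nq pq i t t0 tL.
  have [p0 pl pd] := np i; have [q0 ql qd] := nq i.
  have l : lipschitz_itv (n%:R * d) 0 L (fun t => p' i t - q' i t).
    apply: (@lipschitz_itv_derive _ _ _ _ _ (fun t => rhs p i t - rhs q i t)).
    - by apply: within_continuousB; apply: lipschitz_itv_continuous;
        [exact: pl|exact: ql].
    - by move=> u uL; apply: is_derive1_sub; [exact: pd|exact: qd].
    - move=> u uL; apply: rhs_diff => // k; move: uL; rewrite in_itv/=.
      by move=> /andP[/ltW u0 /ltW uL]; exact: pq.
  have := l 0 t (lexx 0) t0 tL; rewrite p0 q0 subrr !subr0 => h.
  apply: (le_trans h); apply: (@le_trans _ _ (n%:R * d * L)).
    by rewrite ler_wpM2l// mulr_ge0.
  rewrite (_ : _ * L = d * (n%:R * L)); last by ring.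
  by rewrite ler_wpM2l.
have ok0 : ok (fun i _ => x0 i).
  move=> i; split=> [s t s0 st tL|t _ _]; first
    by rewrite subrr normr0 mulr_ge0// subr_ge0.
  by apply: (le_trans (x0m i)); lra.
(* Choice needs a total map; a function that is not [ok] is sent to itself. *)
have [nx Hnx] : exists nx : ('I_n -> R -> R) -> ('I_n -> R -> R),
    forall p, ok p -> isnext p (nx p) /\ ok (nx p).
  have H p : exists q, ok p -> isnext p q /\ ok q.
    by have [/next[q]|] := pselect (ok p); [exists q|exists p].
  by have [nx] := choice H; exists nx.
pose u j := iter j nx (fun i _ => x0 i).
have oku j : ok (u j) by elim: j => [//|j IH]; exact: (Hnx _ IH).2.
have incr j i t : 0 <= t -> t <= L -> `|u j.+1 i t - u j i t| <= 4 * m / 2 ^+ j.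
  elim: j i t => [|j IH] i t t0 tL.
    rewrite expr0 divr1; apply: (le_trans (ler_normB _ _)).
    by have := (oku 1%N i).2 t t0 tL; have := (oku 0%N i).2 t t0 tL; lra.
  rewrite exprSr invfM mulrA.
  apply: (contract (u j.+1) (u j)) => //; try exact: (Hnx _ (oku _)).1.
  by rewrite !mulr_ge0// invr_ge0 exprn_ge0.
have [x Hx] : exists x : 'I_n -> R -> R, forall i t, 0 <= t -> t <= L ->
    forall j, `|u j i t - x i t| <= 8 * m / 2 ^+ j.
  have H (it : 'I_n * R) : exists l, 0 <= it.2 -> it.2 <= L ->
      forall j, `|u j it.1 it.2 - l| <= 8 * m / 2 ^+ j.
    case: it => i t /=.
    have [/andP[t0 tL]|h] := boolP (0 <= t <= L); last first.
      by exists 0 => t0 tL; move: h; rewrite t0 tL.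
    have [l Hl] := geometric_increments_limit (fun j => incr j i t t0 tL).
    exists l => _ _ j; rewrite (_ : 8 * m = 2 * (4 * m)) ?Hl//; ring.
  have [l Hl] := choice H; exists (fun i t => l (i, t)) => i t.
  exact: (Hl (i, t)).
have m8 : 0 <= 8 * m by rewrite mulr_ge0.
have okx : ok x.
  move=> i; split=> [s t s0 st tL|t t0 tL].
    apply: (@ler_add_geometric _ _ _ (16 * m)) => [|j]; first
      by rewrite mulr_ge0.
    have h1 := Hx i s s0 (le_trans st tL) j; have h2 :=
      Hx i t (le_trans s0 st) tL j.
    have h3 := (oku j i).1 s t s0 st tL.
    rewrite (_ : x i t - x i s = (u j i t - u j i s) - (u j i t - x i t)
      + (u j i s - x i s)); last by ring.
    apply: (le_trans (ler_normD _ _)).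
    rewrite (_ : 16 * m / 2 ^+ j = 8 * m / 2 ^+ j + 8 * m / 2 ^+ j); last
      by ring.
    rewrite addrA lerD// (le_trans (ler_normB _ _))// lerD//.
  apply: (@ler_add_geometric _ _ _ (8 * m)) => // j.
  have h1 := Hx i t t0 tL j; have h2 := (oku j i).2 t t0 tL.
  rewrite (_ : x i t = u j i t - (u j i t - x i t)); last by ring.
  by apply: (le_trans (ler_normB _ _)); exact: lerD.
have [nxx _] := Hnx _ okx.
(* Iterate j + 1 is close to x by convergence, and close to the image of x by contraction applied to
   iterate j and x. *)
have fixx i t : 0 <= t -> t <= L -> nx x i t = x i t.
  move=> t0 tL; apply/eqP; rewrite -subr_eq0 -normr_le0.
  apply: (@ler_add_geometric _ _ _ (8 * m)) => // j; rewrite add0r.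
  have h1 := Hx i t t0 tL j.+1.
  have h2 : `|u j.+1 i t - nx x i t| <= 8 * m / 2 ^+ j / 2.
    apply: (contract (u j) x) => //; last by move=> k r r0 rL; exact: Hx.
      by rewrite !mulr_ge0// invr_ge0 exprn_ge0.
    exact: (Hnx _ (oku _)).1.
  rewrite (_ : _ - _ = (u j.+1 i t - x i t) - (u j.+1 i t - nx x i t));
    last by ring.
  apply: (le_trans (ler_normB _ _)); rewrite [leRHS]splitr lerD//.
  by apply: (le_trans h1); rewrite exprSr invfM mulrA.
exists K, x; split=> i.
- by have [n0 _ _] := nxx i; rewrite -(fixx i 0)// ltW.
- exact: (okx i).1.
- move=> t tL; have [_ _ nd] := nxx i.
  apply: (is_derive1_eq_itv (f := nx x i) tL); last exact: nd.
  by move=> s; rewrite in_itv/= => /andP[/ltW s0 /ltW sL]; exact: fixx.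
Qed.

(** * Frames along the curve *)

Definition i0 : 'I_3 := ord0.
Definition i1 : 'I_3 := lift ord0 ord0.
Definition i2 : 'I_3 := lift ord0 (lift ord0 ord0).

Lemma sum_ord3 (R : realType) (F : 'I_3 -> R) : \sum_i F i = F i0 + F i1 + F i2.
Proof. by rewrite !big_ord_recl big_ord0 addr0 addrA. Qed.

Lemma ord3_ind (P : 'I_3 -> Prop) : P i0 -> P i1 -> P i2 -> forall i, P i.
Proof.
move=> p0 p1 p2 [[|[|[|//]]] h].
- by rewrite (_ : Ordinal h = i0)//; exact: val_inj.
- by rewrite (_ : Ordinal h = i1)//; exact: val_inj.
- by rewrite (_ : Ordinal h = i2)//; exact: val_inj.
Qed.

(* A relatively parallel (Bishop) frame [e 0, e 1, e 2]: the tangent of the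
   curve [e 0] is [c *: e 1 + s *: e 2]; the second index is the coordinate. *)
Lemma parallel_frame_exists (R : realType) (L : R) (c s : R -> R) :
  0 < L -> L <= 6^-1 ->
  {in `]0, L[, continuous c} -> {in `]0, L[, continuous s} ->
  (forall t, `|c t| <= 1) -> (forall t, `|s t| <= 1) ->
  exists (K : R) (e : 'I_3 -> 'I_3 -> R -> R),
    [/\ forall i j, lipschitz_itv K 0 L (e i j),
        forall j t, t \in `]0, L[ ->
          [/\ is_derive t 1 (e i0 j) (c t * e i1 j t + s t * e i2 j t),
              is_derive t 1 (e i1 j) (- c t * e i0 j t) &
              is_derive t 1 (e i2 j) (- s t * e i0 j t)] &
        forall i k t, 0 <= t -> t <= L ->
          \sum_j e i j t * e k j t = (i == k)%:R].
Proof.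
move=> L0 L6 cc sc c1 s1.
pose A (i k : 'I_3) : R -> R :=
  if i == i0 then (if k == i1 then c else if k == i2 then s else cst 0)
  else if i == i1 then (if k == i0 then (fun t => - c t) else cst 0)
  else (if k == i0 then (fun t => - s t) else cst 0).
have Ac i k : {in `]0, L[, continuous (A i k)}.
  move=> t tL; have z : {for t, continuous (cst 0 : R -> R)} by exact: cvg_cst.
  have ct := cc t tL; have st := sc t tL.
  rewrite /A; do ! case: ifP => _ //; by apply: cvgN.
have A1 i k t : t \in `]0, L[ -> `|A i k t| <= 1.
  by move=> _; rewrite /A; do ! case: ifP => _; rewrite ?normrN ?normr0.
have L3 : 3%:R * L <= 2^-1 by lra.
(* The system mixes frame vectors but not coordinates: for each coordinate j it is solved in three
   scalar unknowns, starting from the standard basis. *)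
have H j := linear_ode (fun i => (i == j)%:R) L0 L3 Ac A1.
have [K HK] := choice H; have [x Hx] := choice HK.
pose M := \sum_j `|K j|.
have KM j : K j <= M.
  by rewrite (le_trans (ler_norm _))// /M (bigD1 j)//= lerDl sumr_ge0.
exists M, (fun i j => x j i); split.
- move=> i j p q p0 pq qL; have [_ l _] := Hx j.
  by apply: (le_trans (l i p q p0 pq qL)); rewrite ler_wpM2r// subr_ge0.
- move=> j t tL; have [_ _ d] := Hx j.
  split; [apply: is_derive1_val (d i0 t tL) _|apply: is_derive1_val (d i1 t tL) _
         |apply: is_derive1_val (d i2 t tL) _]; rewrite sum_ord3 /A /= /cst;
           ring.
- have xc j i : {within `[0, L], continuous (x j i)}.
    by have [_ l _] := Hx j; exact: lipschitz_itv_continuous (l i).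
  (* Antisymmetry of A preserves dot products of two solutions, that is, sums over the frame index.
     The claim sums over coordinates instead; a one-sided inverse of a square matrix being
     two-sided, [mulmx1C] exchanges the two. *)
  have gram j k t : 0 <= t -> t <= L -> \sum_i x j i t * x k i t = (j == k)%:R.
    move=> t0 tL; pose g t :=
      x j i0 t * x k i0 t + x j i1 t * x k i1 t + x j i2 t * x k i2 t.
    have gc : {within `[0, L], continuous g}.
      by apply: within_continuousD; [apply: within_continuousD|];
        apply: within_continuousM; exact: xc.
    have gd u : u \in `]0, L[ -> is_derive u 1 g 0.
      move=> uL; have [_ _ dj] := Hx j; have [_ _ dk] := Hx k.
      have D i := is_derive1_mul (dj i u uL) (dk i u uL).
      apply: (is_derive1_val (is_derive1_add (is_derive1_add (D i0) (D i1)) (D i2))).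
      by rewrite !sum_ord3 /A /= /cst; ring.
    have g0 : lipschitz_itv 0 0 L g.
      by apply: (lipschitz_itv_derive gc gd) => u _; rewrite normr0.
    have := g0 0 t (lexx 0) t0 tL; rewrite mul0r normr_le0 subr_eq0 => /eqP.
    rewrite sum_ord3 -/(g t) => ->.
    have [ij _ _] := Hx j; have [ik _ _] := Hx k; rewrite /g !ij !ik.
    elim/ord3_ind: {+}j; elim/ord3_ind: {+}k => /=;
      by rewrite !(mulr0, mul0r, mulr1, addr0, add0r).
  move=> i k t t0 tL; pose B := \matrix_(i < 3, j < 3) x j i t.
  have BB : B^T *m B = 1%:M.
    apply/matrixP => j l; rewrite !mxE -(gram j l t t0 tL).
    by apply: eq_bigr => r _; rewrite !mxE.
  have /matrixP/(_ i k) := mulmx1C BB; rewrite !mxE => <-.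
  by apply: eq_bigr => r _; rewrite !mxE.
Qed.

(** * The curve coincides with its involute, coordinate by coordinate *)

Section involute_coordinate.
Context {R : realType}.
Variables (L K C : R) (f Theta x y z : R -> R).
Hypotheses (L1 : L <= 1) (K0 : 0 <= K).
Let c t := cos (Theta t).
Let s t := sin (Theta t).
Hypothesis f_range : forall t, t \in `]0, L[ -> 0 < f t /\ f t <= t.
Hypothesis df : forall t, t \in `]0, L[ -> is_derive t 1 f (involute_rate f t).
Let k t := cos (f t) / sin (f t).
Hypothesis dTheta : forall t, t \in `]0, L[ -> is_derive t 1 Theta (k t).
Hypothesis Theta_shift : forall t, 0 < t -> t < L ->
  `|Theta t - Theta (f t) - 3 * (pi / 2)| <= C * t.
Hypothesis dx : forall t, t \in `]0, L[ ->
  is_derive t 1 x (c t * y t + s t * z t).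
Hypothesis dy : forall t, t \in `]0, L[ -> is_derive t 1 y (- c t * x t).
Hypothesis dz : forall t, t \in `]0, L[ -> is_derive t 1 z (- s t * x t).
Hypothesis xl : lipschitz_itv K 0 L x.
Hypothesis yl : lipschitz_itv K 0 L y.
Hypothesis zl : lipschitz_itv K 0 L z.
Hypothesis B1 : forall t, 0 <= t -> t <= L -> [/\ `|x t| <= 1,
  `|y t| <= 1 & `|z t| <= 1].

Let T t := c t * y t + s t * z t.
Let N t := c t * z t - s t * y t.

(** A Frenet equation on the sphere: rotating the parallel frame by an angle with derivative k
    creates the curvature term, and - x is the pull towards the centre. *)
Lemma tangent_derive t : t \in `]0, L[ -> is_derive t 1 T (k t * N t - x t).
Proof.
move=> tL; have dc := is_derive1_compose (is_derive_cos (Theta t)) (dTheta tL).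
have ds := is_derive1_compose (is_derive_sin (Theta t)) (dTheta tL).
have := is_derive1_add (is_derive1_mul dc (dy tL)) (is_derive1_mul ds (dz tL)).
move/is_derive1_val; apply; rewrite /N /c /s.
by rewrite -[in RHS](mul1r (x t)) -(cos2Dsin2 (Theta t)); ring.
Qed.

Lemma normal_derive t : t \in `]0, L[ -> is_derive t 1 N (- (k t * T t)).
Proof.
move=> tL; have dc := is_derive1_compose (is_derive_cos (Theta t)) (dTheta tL).
have ds := is_derive1_compose (is_derive_sin (Theta t)) (dTheta tL).
have := is_derive1_sub (is_derive1_mul dc (dz tL)) (is_derive1_mul ds (dy tL)).
move/is_derive1_val; apply; rewrite /T /c /s; ring.
Qed.

(* Both (x, T, N) at t and the rotated frame at f t solve the same Frenet
   system, whose matrix is antisymmetric: the squared distance of the two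
   solutions is constant. *)
Let D1 t := x t - (cos (f t) * x (f t) - sin (f t) * T (f t)).
Let D2 t := T t + N (f t).
Let D3 t := N t - (sin (f t) * x (f t) + cos (f t) * T (f t)).
Let E t := D1 t * D1 t + D2 t * D2 t + D3 t * D3 t.

Let f_in t : t \in `]0, L[ -> f t \in `]0, L[.
Proof.
move=> tL; have [f0 ft] := f_range tL; move: tL; rewrite !in_itv/= =>
  /andP[t0 tL].
by rewrite f0 (le_lt_trans ft).
Qed.

Let sin_f t : t \in `]0, L[ -> 0 < sin (f t).
Proof.
move=> /f_in; rewrite in_itv/= => /andP[f0 fL].
by apply: sin_gt0_unit => //; apply: le_trans L1; exact: ltW.
Qed.

Let cos_f t : t \in `]0, L[ -> 0 < cos (f t).
Proof.
move=> /f_in; rewrite in_itv/= => /andP[f0 fL].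
by apply: cos_gt0_unit => //; [|apply: le_trans L1]; exact: ltW.
Qed.

(** The functional equation read geometrically: the involute has speed sin (f t) k (f t) at
    parameter f t, so following it along f gives unit speed. *)
Let rate_k t : t \in `]0, L[ -> involute_rate f t * k (f t) = (sin (f t))^-1.
Proof.
move=> tL; have s1 := sin_f tL; have s2 := sin_f (f_in tL); have c2 :=
  cos_f (f_in tL).
by rewrite /involute_rate /k /tan; field; rewrite !gt_eqF.
Qed.

Let E_derive t : t \in `]0, L[ -> is_derive t 1 E 0.
Proof.
move=> tL; have fL := f_in tL; have f' := df tL.
have cf := is_derive1_compose (is_derive_cos (f t)) f'.
have sf := is_derive1_compose (is_derive_sin (f t)) f'.
have xf := is_derive1_compose (dx fL) f'.
have Tf := is_derive1_compose (tangent_derive fL) f'.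
have Nf := is_derive1_compose (normal_derive fL) f'.
have s0 : sin (f t) != 0 by rewrite gt_eqF// sin_f.
have rk : k (f t) * involute_rate f t = (sin (f t))^-1 by rewrite mulrC rate_k.
have kt : k t = cos (f t) / sin (f t) by [].
have cs := cos2Dsin2 (f t).
have d1 : is_derive t 1 D1 (D2 t).
  apply: is_derive1_val (is_derive1_sub (dx tL)
    (is_derive1_sub (is_derive1_mul cf xf) (is_derive1_mul sf Tf))) _.
  rewrite -/(T t) -/(T (f t)) /D2.
  transitivity (T t + sin (f t) * (k (f t) * involute_rate f t) * N (f t));
    first by ring.
  by rewrite rk divff// mul1r.
have d2 : is_derive t 1 D2 (k t * D3 t - D1 t).
  apply: is_derive1_val (is_derive1_add (tangent_derive tL) Nf) _.
  transitivity (k t * N t - x t - (k (f t) * involute_rate f t) * T (f t));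
    first by ring.
  rewrite rk -[(sin (f t))^-1]mul1r -cs /D3 /D1 kt; field; exact: s0.
have d3 : is_derive t 1 D3 (- (k t * D2 t)).
  apply: is_derive1_val (is_derive1_sub (normal_derive tL)
    (is_derive1_add (is_derive1_mul sf xf) (is_derive1_mul cf Tf))) _.
  rewrite -/(T (f t)) /D2.
  transitivity (- (k t * T t) - cos (f t) * (k (f t) * involute_rate f t) * N (f t));
    first by ring.
  by rewrite rk kt; ring.
apply: is_derive1_val (is_derive1_add (is_derive1_add (is_derive1_mul d1 d1)
  (is_derive1_mul d2 d2)) (is_derive1_mul d3 d3)) _.
by ring.
Qed.

Let E_const u v : 0 < u -> u <= v -> v < L -> E v = E u.
Proof.
move=> u0 uv vL.
have inI t : t \in `[u, v] -> t \in `]0, L[.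
  rewrite !in_itv/= => /andP[ut tv].
  by rewrite (lt_le_trans u0 ut) (le_lt_trans tv vL).
have Ec : {within `[u, v], continuous E}.
  apply: continuous_in_subspaceT => t; rewrite inE/= => /inI tL.
  exact: is_derive1_continuous (E_derive tL).
have Ed t : t \in `]u, v[ -> is_derive t 1 E 0.
  by move=> tI; apply: E_derive; apply: inI; exact: subset_itv_oo_cc.
have E0 : lipschitz_itv 0 u v E.
  by apply: (lipschitz_itv_derive Ec Ed) => t _; rewrite normr0.
have := E0 u v (lexx u) uv (lexx v); rewrite mul0r normr_le0 subr_eq0.
by move/eqP.
Qed.

Let cT t : `|c t| <= 1. Proof. exact: cos_max. Qed.
Let sT t : `|s t| <= 1. Proof. exact: sin_max. Qed.

(** A turn by exactly 3 pi / 2 would replace the cosine by the sine and the sine by minus the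
    cosine, sending T to - N. The angle is off by at most C t, and cosine is 1-Lipschitz. *)
Let cos_shift t : 0 < t -> t < L -> `|c t - s (f t)| <= C * t.
Proof.
move=> t0 tL; apply: le_trans (Theta_shift t0 tL); rewrite /c /s.
have -> : sin (Theta (f t)) = cos (Theta (f t) + 3 * (pi / 2)).
  have -> : Theta (f t) + 3 * (pi / 2) = Theta (f t) + pi + pi / 2 by field.
  by rewrite cosDpihalf sinDpi opprK.
by apply: (le_trans (cos_dist_le _ _)); rewrite opprD addrA.
Qed.

Let sin_shift t : 0 < t -> t < L -> `|s t + c (f t)| <= C * t.
Proof.
move=> t0 tL; apply: le_trans (Theta_shift t0 tL); rewrite /c /s.
have -> : cos (Theta (f t)) = - sin (Theta (f t) + 3 * (pi / 2)).
  have -> : Theta (f t) + 3 * (pi / 2) = Theta (f t) + pi + pi / 2 by field.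
  by rewrite sinDpihalf cosDpi opprK.
by apply: (le_trans (sin_dist_le _ _)); rewrite opprD addrA.
Qed.

Let normM_le (u v a b : R) : `|u| <= a -> `|v| <= b -> `|u * v| <= a * b.
Proof. by move=> ua vb; rewrite normrM ler_pM. Qed.

Let M := C * 2 + K * 2 + 6.

(** T and N themselves need not converge at 0, but these differences do: each splits into the error
    of the angle shift (C), the change of the Lipschitz coordinates from f t to t (K), and the
    distance of the rotation by f t from the identity. *)
Let D_bounds t : 0 < t -> t < L ->
  [/\ `|D1 t| <= M * t, `|D2 t| <= M * t & `|D3 t| <= M * t].
Proof.
move=> t0 tL; have tI : t \in `]0, L[ by rewrite in_itv/= t0.
have [ft0 ftt] := f_range tI; have ftL := ltW (le_lt_trans ftt tL).
have [bx bY bz] := B1 (ltW t0) (ltW tL).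
have [bfx bfy bfz] := B1 (ltW ft0) ftL.
have C0 : 0 <= C * t := le_trans (normr_ge0 _) (Theta_shift t0 tL).
have lip g : lipschitz_itv K 0 L g -> `|g t - g (f t)| <= K * t.
  move=> gl; apply: (le_trans (gl _ _ (ltW ft0) ftt (ltW tL))).
  by rewrite ler_wpM2l// gerBl ltW.
have Kt : 0 <= K * t by rewrite mulr_ge0// ltW.
have sf : `|sin (f t)| <= t.
  have := sin_dist_le (f t) 0; rewrite sin0 !subr0 => h.
  by apply: (le_trans h); rewrite gtr0_norm.
have cf : `|1 - cos (f t)| <= t.
  rewrite -(cos0 R); apply: (le_trans (cos_dist_le _ _)).
  by rewrite sub0r normrN gtr0_norm.
have Tf : `|T (f t)| <= 2.
  apply: (le_trans (ler_normD _ _)).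
  by have := lerD (normM_le (cT (f t)) bfy) (normM_le (sT (f t)) bfz); lra.
have ct := cos_shift t0 tL; have st := sin_shift t0 tL.
have p1 := normM_le ct bY; have p2 := normM_le (sT (f t)) (lip _ yl).
have p3 := normM_le st bz; have p4 := normM_le (cT (f t)) (lip _ zl).
have q1 := normM_le st bY; have q2 := normM_le (cT (f t)) (lip _ yl).
have q3 := normM_le ct bz; have q4 := normM_le (sT (f t)) (lip _ zl).
have r1 := normM_le cf Tf; have r2 := normM_le sf bfx.
have r3 := normM_le cf bfx; have r4 := normM_le sf Tf.
have r5 := lip _ xl.
have addP (u v a b : R) : `|u| <= a -> `|v| <= b -> `|u + v| <= a + b.
  by move=> ua vb; exact: le_trans (ler_normD _ _) (lerD ua vb).
have subP (u v a b : R) : `|u| <= a -> `|v| <= b -> `|u - v| <= a + b.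
  by move=> ua vb; exact: le_trans (ler_normB _ _) (lerD ua vb).
split.
- rewrite (_ : D1 t = (x t - x (f t)) + (1 - cos (f t)) * x (f t)
    + sin (f t) * T (f t)); last by rewrite /D1; ring.
  by apply: le_trans (addP _ _ _ _ (addP _ _ _ _ r5 r3) r4) _; rewrite /M; lra.
- rewrite (_ : D2 t = (c t - s (f t)) * y t + s (f t) * (y t - y (f t))
    + ((s t + c (f t)) * z t - c (f t) * (z t - z (f t))));
    last by rewrite /D2 /T /N; ring.
  apply: le_trans (addP _ _ _ _ (addP _ _ _ _ p1 p2) (subP _ _ _ _ p3 p4)) _.
  by rewrite /M; lra.
- rewrite (_ : D3 t = c (f t) * (y t - y (f t)) - (s t + c (f t)) * y t
    + ((c t - s (f t)) * z t + s (f t) * (z t - z (f t)))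
    + ((1 - cos (f t)) * T (f t) - sin (f t) * x (f t)));
    last by rewrite /D3 /N /T; ring.
  apply: le_trans (addP _ _ _ _ (addP _ _ _ _ (subP _ _ _ _ q2 q1)
    (addP _ _ _ _ q3 q4)) (subP _ _ _ _ r1 r2)) _.
  by rewrite /M; lra.
Qed.

Lemma involute_coordinate t : 0 < t -> t < L ->
  x t = cos (f t) * x (f t) - sin (f t) * T (f t).
Proof.
move=> t0 tL; apply/eqP; rewrite -subr_eq0 -/(D1 t).
have M0 : 0 <= M ^+ 2 * 3 by rewrite mulr_ge0// sqr_ge0.
have E0 : E t <= 0.
  apply: (@ler_add_geometric _ _ _ (M ^+ 2 * 3 * t)) => [|n].
    by rewrite mulr_ge0// ltW.
  have p0 : 0 < 2 ^+ n :> R by rewrite exprn_gt0.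
  (* E takes the same value at t and at u, where it is at most 3 M^2 u^2 <= 3 M^2 u; letting u tend
     to 0 gives E t <= 0. *)
  pose u := t / 2 ^+ n.
  have u0 : 0 < u by rewrite divr_gt0.
  have ut : u <= t
    by rewrite ler_pdivrMr// ler_peMr ?(ltW t0)// exprn_ege1// ler1n.
  have uL := le_lt_trans ut tL.
  rewrite add0r (E_const u0 ut tL) -mulrA -/u.
  have [b1 b2 b3] := D_bounds u0 uL.
  have sq d : `|d| <= M * u -> d * d <= M ^+ 2 * u.
    move=> h; rewrite -expr2 -real_normK ?num_real// expr2.
    apply: (le_trans (ler_pM _ _ h h)) => //.
    rewrite (_ : M * u * (M * u) = M ^+ 2 * u * u); last by ring.
    apply: ler_piMr; first by rewrite mulr_ge0 ?sqr_ge0// ltW.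
    by apply: le_trans L1; exact: ltW.
  by have := sq _ b1; have := sq _ b2; have := sq _ b3; rewrite /E; lra.
have h1 : D1 t * D1 t <= 0.
  have := sqr_ge0 (D2 t); have := sqr_ge0 (D3 t); rewrite !expr2.
  by move: E0; rewrite /E; lra.
by rewrite -sqrf_eq0 expr2 eq_le h1 -expr2 sqr_ge0.
Qed.

End involute_coordinate.

(** * Length of curves *)

Lemma polygonal_length_nil (R : realType) (a b : R) c : polygonal_length a b c [::] = 0.
Proof. by rewrite /polygonal_length big_geq. Qed.

Lemma polygonal_length_cons (R : realType) (a b x : R) c s :
  polygonal_length a b c (x :: s) = enorm (c x - c a) + polygonal_length x b c s.
Proof. by rewrite /polygonal_length /= big_nat_recl. Qed.

Lemma polygonal_length_cat (R : realType) (a b d : R) c s t :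
  itv_partition a b s ->
  polygonal_length a d c (s ++ t) = polygonal_length a b c s + polygonal_length b d c t.
Proof.
elim: s a => [a /itv_partition_nil ->|x s IH a /itv_partition_cons/IH h] /=.
  by rewrite polygonal_length_nil add0r.
by rewrite !polygonal_length_cons h addrA.
Qed.

Lemma polygonal_length_le_curve_length (R : realType) (a b : R) c s :
  itv_partition a b s ->
    ((polygonal_length a b c s)%:E <= curve_length a b c)%E.
Proof. by move=> sP; apply: ereal_sup_ubound; exists s. Qed.

Lemma polygonal_length_map (R : realType) (a b : R) (h : R -> R) c1 c2 s :
  (forall x y, a <= x -> x < y -> y <= b -> h x < h y) ->
  (forall x, a <= x -> x <= b -> c1 x = c2 (h x)) ->
  itv_partition a b s ->
  itv_partition (h a) (h b) (map h s) /\
  polygonal_length a b c1 s = polygonal_length (h a) (h b) c2 (map h s).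
Proof.
elim: s a => [a _ _ /itv_partition_nil ->|x s IH a hlt ch P].
  by rewrite !polygonal_length_nil; split=> //; split.
have P' := itv_partition_cons P; have xb := itv_partition_le P'.
have ax : a < x by case: P => /= /andP[].
have [|||[p1 p2] e] := IH x.
- by move=> u v xu; apply: hlt; exact: le_trans (ltW ax) xu.
- by move=> u xu; apply: ch; exact: le_trans (ltW ax) xu.
- exact: P'.
have ca : c1 a = c2 (h a) by apply: ch => //; exact: ltW (lt_le_trans ax xb).
have cx : c1 x = c2 (h x) by apply: ch => //; exact: ltW.
rewrite /= !polygonal_length_cons e ca cx; split=> //; split=> //=.
by rewrite p1 andbT; exact: hlt.
Qed.

Lemma curve_length_comp_le (R : realType) (a b : R) (h : R -> R) c1 c2 :
  (forall x y, a <= x -> x < y -> y <= b -> h x < h y) ->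
  (forall x, a <= x -> x <= b -> c1 x = c2 (h x)) ->
  (curve_length a b c1 <= curve_length (h a) (h b) c2)%E.
Proof.
move=> hlt ch; apply: ge_ereal_sup => _ [s sP <-].
have [hP ->] := polygonal_length_map hlt ch sP.
exact: polygonal_length_le_curve_length.
Qed.

(** Chords no longer than the parameter bound all polygons from above. From below, bisecting a
    segment halves its quadratic defect, since 2 (d/2)^2 = d^2/2. The constant K may blow up as r
    tends to 0, as it must for a curve of unbounded curvature. *)
Lemma arclength_param_of_chords (R : realType) (L : R) (c : R -> 'rV[R]_3) :
  (forall s t, 0 <= s -> s <= t -> t <= L -> enorm (c t - c s) <= t - s) ->
  (forall r, 0 < r -> exists2 K, 0 <= K & forall s t, r <= s -> s <= t ->
    t <= L ->
    t - s - K * (t - s) ^+ 2 <= enorm (c t - c s)) ->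
  arclength_param L c.
Proof.
move=> up lo s t s0 st tL.
have halving r K : 0 < r -> 0 <= K -> (forall s t, r <= s -> s <= t -> t <= L ->
      t - s - K * (t - s) ^+ 2 <= enorm (c t - c s)) ->
    forall n s t, r <= s -> s <= t -> t <= L -> exists2 p, itv_partition s t p &
      t - s - K * (t - s) ^+ 2 / 2 ^+ n <= polygonal_length s t c p.
  move=> r0 K0 lorK; elim=> [|n IH] u v ru uv vL.
    have [<-|uv'] := eqVneq u v.
      exists [::]; first by split.
      by rewrite polygonal_length_nil subrr expr0n mulr0 mul0r subrr.
    exists [:: v]; first by apply: itv_partition1; rewrite lt_neqAle uv'.
    rewrite polygonal_length_cons polygonal_length_nil addr0 expr0 divr1.
    exact: lorK.
  pose m := (u + v) / 2.
  have um : u <= m by rewrite /m; lra.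
  have mv : m <= v by rewrite /m; lra.
  have [p pP pl] := IH u m ru um (le_trans mv vL).
  have [q qP ql] := IH m v (le_trans ru um) mv vL.
  exists (p ++ q); first exact: itv_partition_cat pP qP.
  rewrite (polygonal_length_cat _ _ _ pP); apply: le_trans (lerD pl ql).
  rewrite le_eqVlt; apply/orP; left; apply/eqP.
  by rewrite /m (exprS 2 n); field; rewrite expf_neq0.
have upper p u v : 0 <= u -> v <= L -> itv_partition u v p ->
  polygonal_length u v c p <= v - u.
  elim: p u => [|x p IH] u u0 vL P.
    by rewrite polygonal_length_nil (itv_partition_nil P) subrr.
  have P' := itv_partition_cons P; have xv := itv_partition_le P'.
  have ux : u < x by case: P => /= /andP[].
  have h1 := up u x u0 (ltW ux) (le_trans xv vL).
  have h2 := IH x (le_trans u0 (ltW ux)) vL P'.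
  by rewrite polygonal_length_cons; lra.
apply/eqP; rewrite eq_le; apply/andP; split.
  apply: ge_ereal_sup => _ [p pP <-]; rewrite lee_fin; exact: upper.
have [<-|st'] := eqVneq s t.
  rewrite subrr -(polygonal_length_nil s s c).
  by apply: polygonal_length_le_curve_length; split.
have st1 : s < t by rewrite lt_neqAle st'.
have low u q : s < u -> itv_partition u t q ->
    ((polygonal_length u t c q)%:E <= curve_length s t c)%E.
  move=> su qP; have := itv_partition_cat (itv_partition1 su) qP.
  move/(polygonal_length_le_curve_length c); apply: le_trans.
  by rewrite lee_fin /= polygonal_length_cons lerDr sqrtr_ge0.
case E : (curve_length s t c) => [r| |]; last 2 first.
- by rewrite leey.
- by have := polygonal_length_le_curve_length c (itv_partition1 st1); rewrite E.
rewrite lee_fin; apply: (@ler_add_geometric _ _ _ (t - s)); first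
  by rewrite subr_ge0.
move=> n; have p0 : 0 < 2 ^+ n :> R by rewrite exprn_gt0.
(* If s = 0 no K is available on [s, t], so bisection is done on [u, t] with u > 0, at the cost of a
   length d that tends to 0. *)
pose d := (t - s) / 2 ^+ n; pose u := s + d.
have d0 : 0 < d by rewrite divr_gt0// subr_gt0.
have dle : d <= t - s.
  by rewrite ler_pdivrMr// ler_peMr ?subr_ge0// exprn_ege1// ler1n.
have u0 : 0 < u by rewrite ltr_wpDl.
have ut : u <= t by rewrite /u; lra.
have [K K0 hK] := lo u u0.
rewrite -/d -lerBlDr (_ : t - s - d = t - u); last by rewrite /u; ring.
apply: (@ler_add_geometric _ _ _ (K * (t - u) ^+ 2)) => [|m].
  by rewrite mulr_ge0// sqr_ge0.
have [q qP ql] := halving u K u0 K0 hK m u t (lexx u) ut tL.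
rewrite -lerBlDr (le_trans ql)//.
have su : s < u by rewrite /u ltrDl.
by have := low u q su qP; rewrite E lee_fin.
Qed.

(** * Unit speed curves in coordinates *)

Lemma cvg_row (R : realType) (T : Type) (F : set_system T) (n : nat)
    (g : T -> 'rV[R]_n) (l : 'rV[R]_n) : Filter F ->
  (forall j, g x 0 j @[x --> F] --> l 0 j) -> g x @[x --> F] --> l.
Proof.
move=> FF gl; apply/cvgrPdist_le => e e0; near=> x.
rewrite /Num.Def.normr/= mx_normrE (bigmax_le _ (ltW e0))//= => -[i j] _.
rewrite !mxE/= ord1; move: j; near: x; apply: filter_forall => j.
by move/cvgrPdist_le : (gl j) => /(_ _ e0).
Unshelve. all: by end_near. Qed.

Lemma derive1_row (R : realType) (n : nat) (g : R ->
  'rV[R]_n) (s : R) (d : 'rV[R]_n) :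
  (forall j, is_derive s 1 (fun t => g t 0 j) (d 0 j)) ->
  derivable g s 1 /\ derive1 g s = d.
Proof.
move=> gd.
have dg : derivable g s 1.
  by apply/derivable_mxP => i j; rewrite ord1;
    exact: (@ex_derive _ _ _ _ _ _ _ (gd j)).
split=> //; rewrite derive1E derive_mx//; apply/rowP => j; rewrite !mxE.
exact: (@derive_val _ _ _ _ _ _ _ (gd j)).
Qed.

(** Cauchy-Schwarz, from the Lagrange identity: the defect is the sum of the squared 2 x 2
    minors. *)
Lemma dot_unit_le (R : realType) (u v : 'I_3 -> R) : \sum_j v j ^+ 2 = 1 ->
  \sum_j u j * v j <= Num.sqrt (\sum_j u j ^+ 2).
Proof.
move=> v1; apply: (le_trans (ler_norm _)); rewrite -sqrtr_sqr;
  apply: ler_wsqrtr.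
rewrite -[leRHS]mulr1 -v1 !sum_ord3 -subr_ge0.
have := sqr_ge0 (u i0 * v i1 - u i1 * v i0).
have := sqr_ge0 (u i0 * v i2 - u i2 * v i0).
have := sqr_ge0 (u i1 * v i2 - u i2 * v i1).
by move=> h1 h2 h3; have := addr_ge0 (addr_ge0 h1 h2) h3; congr (0 <= _); ring.
Qed.

Section unit_speed_chords.
Context {R : realType}.
Variables (L : R) (x T : 'I_3 -> R -> R).
Hypothesis xc : forall j, {within `[0, L], continuous (x j)}.
Hypothesis dx : forall j t, t \in `]0, L[ -> is_derive t 1 (x j) (T j t).
Hypothesis T1 : forall t, t \in `]0, L[ -> \sum_j T j t ^+ 2 = 1.

Let chord s t := \sum_j (x j t - x j s) ^+ 2.

(** The mean value theorem fails for vectors but holds for the projection on a fixed direction v. *)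
Let chord_mean_value (v : 'I_3 -> R) s t : 0 <= s -> s < t -> t <= L ->
  exists2 r, s < r < t &
    \sum_j v j * (x j t - x j s) = (\sum_j v j * T j r) * (t - s).
Proof.
move=> s0 st tL; pose p u := v i0 * x i0 u + v i1 * x i1 u + v i2 * x i2 u.
have pc : {within `[0, L], continuous p}.
  by apply: within_continuousD; [apply: within_continuousD|];
    apply: within_continuousM => //; exact/continuous_subspaceT/cst_continuous.
have pd u : u \in `]0, L[ -> is_derive u 1 p (\sum_j v j * T j u).
  move=> uL; rewrite sum_ord3.
  by apply: is_derive1_add; [apply: is_derive1_add|];
    apply: is_derive1_scale; exact: dx.
have [r [sr rt E]] := mean_value pc pd s0 st tL.
by exists r; [rewrite sr|rewrite -E sum_ord3 /p; ring].
Qed.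

Lemma unit_speed_chord_le s t : 0 <= s -> s <= t -> t <= L ->
  Num.sqrt (chord s t) <= t - s.
Proof.
move=> s0 + tL; rewrite le_eqVlt => /predU1P[<-|st].
  by rewrite /chord big1 ?sqrtr0 ?subrr// => j _; rewrite subrr expr0n.
(* Projecting on the chord itself bounds its squared length by its length times t - s. *)
have [r /andP[sr rt] E] := chord_mean_value (fun j => x j t - x j s) s0 st tL.
have rL : r \in `]0, L[
  by rewrite in_itv/= (le_lt_trans s0 sr) (lt_le_trans rt tL).
have h := dot_unit_le (fun j => x j t - x j s) (T1 rL).
have n0 : 0 <= chord s t by apply: sumr_ge0 => j _; exact: sqr_ge0.
have : Num.sqrt (chord s t) ^+ 2 <= Num.sqrt (chord s t) * (t - s).
  have cE : chord s t = (\sum_j (x j t - x j s) * T j r) * (t - s).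
    by rewrite -E; apply: eq_bigr => j _; rewrite expr2.
  rewrite sqr_sqrtr// cE; apply: ler_wpM2r; first by rewrite subr_ge0 ltW.
  by rewrite -cE.
have [->|n1] := eqVneq (Num.sqrt (chord s t)) 0.
  by move=> _; rewrite subr_ge0; exact: ltW.
by rewrite expr2 ler_pM2l// lt_neqAle eq_sym n1 sqrtr_ge0.
Qed.

(** The chord is at least its projection on T s, which is (t - s) times the dot product of T s with
    some T u. For unit vectors that product is 1 minus half their squared distance; three
    coordinates, each Lipschitz, give the 3 / 2. As u - s <= 1, its square is bounded by t - s. *)
Lemma unit_speed_chord_ge (r b kappa : R) : 0 < r -> b < L -> b - r <= 1 ->
  (forall j, lipschitz_itv kappa r b (T j)) ->
  forall s t, r <= s -> s <= t -> t <= b ->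
    t - s - 3 / 2 * kappa ^+ 2 * (t - s) ^+ 2 <= Num.sqrt (chord s t).
Proof.
move=> r0 bL br Tl s t rs + tb; rewrite le_eqVlt => /predU1P[<-|st].
  by rewrite subrr expr0n mulr0 subr0 sqrtr_ge0.
have s0 := lt_le_trans r0 rs; have tL := le_lt_trans tb bL.
have sI : s \in `]0, L[ by rewrite in_itv/= s0 (lt_trans st tL).
have h := dot_unit_le (fun j => x j t - x j s) (T1 sI); apply: le_trans h.
have [u /andP[su ut] E] := chord_mean_value (fun j =>
  T j s) (ltW s0) st (ltW tL).
have uI : u \in `]0, L[ by rewrite in_itv/= (lt_trans s0 su) (lt_trans ut tL).
rewrite (_ : \sum_j _ = \sum_j T j s * (x j t - x j s)); last first.
  by apply: eq_bigr => j _; rewrite mulrC.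
rewrite E.
have d2 j : (T j u - T j s) ^+ 2 <= kappa ^+ 2 * (t - s).
  have := Tl j s u rs (ltW su) (ltW (lt_le_trans ut tb)) => hl.
  rewrite -real_normK ?num_real// expr2.
  apply: (le_trans (ler_pM _ _ hl hl)) => //.
  rewrite (_ : _ * _ * _ = kappa ^+ 2 * (u - s) ^+ 2); last by ring.
  apply: ler_wpM2l; first exact: sqr_ge0.
  have h0 : 0 <= u - s by lra.
  have h1 : u - s <= 1 by lra.
  rewrite expr2; apply: (@le_trans _ _ (u - s)); first by rewrite ler_piMl.
  lra.
have e1 := T1 sI; have e2 := T1 uI; rewrite !sum_ord3 in e1 e2 *.
have := d2 i0; have := d2 i1; have := d2 i2 => q2 q1 q0.
have : 1 - 3 / 2 * (kappa ^+ 2 * (t - s)) <=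
    T i0 s * T i0 u + T i1 s * T i1 u + T i2 s * T i2 u.
  have -> : T i0 s * T i0 u + T i1 s * T i1 u + T i2 s * T i2 u =
    (T i0 s ^+ 2 + T i1 s ^+ 2 + T i2 s ^+ 2) / 2
    + (T i0 u ^+ 2 + T i1 u ^+ 2 + T i2 u ^+ 2) / 2
    - ((T i0 u - T i0 s) ^+ 2 + (T i1 u - T i1 s) ^+ 2 + (T i2 u - T i2 s) ^+ 2) / 2.
    by field.
  rewrite e1 e2; lra.
have ts : 0 <= t - s by lra.
move/(ler_wpM2r ts); apply: le_trans.
by rewrite le_eqVlt; apply/orP; left; apply/eqP; ring.
Qed.

End unit_speed_chords.

(** * Self-involute curves *)

(** The involute's length is found without differentiating it: an increasing substitution cannot
    decrease the supremum over polygons, and using h and its inverse k gives both inequalities. *)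
Lemma curve_length_reparam (R : realType) (L : R) (h : R -> R)
    (eta g : R -> 'rV[R]_3) : h 0 = 0 ->
  (forall s t, 0 <= s -> s < t -> t <= L -> h s < h t) ->
  {within `[0, L], continuous h} ->
  arclength_param L eta -> (forall s, 0 <= s -> s <= L -> eta s = g (h s)) ->
  forall s, 0 <= s -> s <= L -> curve_length 0 (h s) g = s%:E.
Proof.
move=> h0 hlt hc etal etag s s0 sL.
have len := etal 0 s (lexx 0) s0 sL; rewrite subr0 in len.
have hle u v : 0 <= u -> u <= v -> v <= L -> h u <= h v.
  move=> u0 + vL; rewrite le_eqVlt => /predU1P[->//|uv].
  by apply: ltW; exact: hlt.
have inv t : exists u, 0 <= t -> t <= h s -> [/\ 0 <= u, u <= s & h u = t].
  have [/andP[t0 ts]|nt] := boolP (0 <= t <= h s); last first.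
    by exists 0 => t0 ts; rewrite t0 ts in nt.
  have hc' := within_continuous_sub hc (lexx 0) sL.
  have [|u uI hu] := IVT s0 hc' (v := t).
    by rewrite h0 ge_min le_max t0 ts orbT.
  by exists u => _ _; move: uI; rewrite in_itv/= => /andP[].
have [k Hk] := choice inv.
have k_eq u : 0 <= u -> u <= s -> k (h u) = u.
  move=> u0 us; have hu0 : 0 <= h u by rewrite -h0 hle// (le_trans us).
  have [k0 ks hk] := Hk (h u) hu0 (hle _ _ u0 us sL).
  have [lt|lt|//] := ltgtP (k (h u)) u.
    by have := hlt _ _ k0 lt (le_trans us sL); rewrite hk ltxx.
  by have := hlt _ _ u0 lt (le_trans ks sL); rewrite hk ltxx.
apply: le_anti; rewrite -len; apply/andP; split.
  have k0 : k 0 = 0 by rewrite -{1}h0 k_eq.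
  have := @curve_length_comp_le R 0 (h s) k g eta.
  rewrite k0 k_eq//; apply=> [x y x0 xy ys|x x0 xs].
    have [kx0 kxs hkx] := Hk x x0 (le_trans (ltW xy) ys).
    have [ky0 kys hky] := Hk y (le_trans x0 (ltW xy)) ys.
    rewrite ltNge; apply/negP => kyx.
    by have := hle _ _ ky0 kyx (le_trans kxs sL); rewrite hkx hky leNgt xy.
  have [kx0 ks hk] := Hk x x0 xs.
  by rewrite etag// ?hk// (le_trans ks).
rewrite -{2}h0; apply: curve_length_comp_le => [x y x0 xy ys|x x0 xs].
  by apply: hlt => //; exact: le_trans sL.
by apply: etag => //; exact: le_trans sL.
Qed.

(** A single curve on [0, Lo] serves every L, because each of its initial arcs is self-involute. The
    strict L < Lo makes L an interior point, so that f, the tangent and the involute relation are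
    controlled there. *)
Lemma self_involute_exists (R : realType) (a Lo : R) : 0 < a -> a < 1 ->
  a^-1 * ln a^-1 = 3 * (pi / 2) -> 0 < Lo -> Lo <= 6^-1 ->
    9 * Lo ^+ 2 <= 1 - a ->
  forall L, 0 < L -> L < Lo -> exists eta : R -> 'rV[R]_3, self_involute L eta.
Proof.
move=> a0 a1 aM Lo0 Lo6 aLo L L0 LLo.
have Lo1 : Lo <= 1 by lra.
have [f [fa fd]] := involute_rate_solution a0 a1 Lo0 aLo.
have [Th [dTh [C ThC]]] := exists_tangent_angle a0 a1 Lo0 aLo fa.
rewrite aM in ThC.
have Thc t : t \in `]0, Lo[ -> {for t, continuous Th}.
  by move=> tL; exact: is_derive1_continuous (dTh t tL).
pose c t := cos (Th t); pose s t := sin (Th t).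
have cc : {in `]0, Lo[, continuous c}.
  move=> t tL; apply: (@continuous_comp _ _ _ Th cos); first exact: Thc.
  exact: continuous_cos.
have sc : {in `]0, Lo[, continuous s}.
  move=> t tL; apply: (@continuous_comp _ _ _ Th sin); first exact: Thc.
  exact: continuous_sin.
have [K [e [el de gram]]] := parallel_frame_exists Lo0 Lo6 cc sc
  (fun t => cos_max (Th t)) (fun t => sin_max (Th t)).
have K0 : 0 <= K.
  have := el i0 i0 0 Lo (lexx 0) (ltW Lo0) (lexx _); rewrite subr0.
  by move/(le_trans (normr_ge0 _)); rewrite pmulr_lge0.
have e1 i j t : 0 <= t -> t <= Lo -> `|e i j t| <= 1.
  move=> t0 tL; have := gram i i t t0 tL; rewrite eqxx mulr1n => g1.
  have : e i j t ^+ 2 <= 1.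
    rewrite -g1 (bigD1 j)//= -expr2 lerDl sumr_ge0// => k _.
    by rewrite -expr2 sqr_ge0.
  by rewrite -{1}real_normK ?num_real// expr_le1.
have ec i j : {within `[0, Lo], continuous (e i j)}.
  exact: lipschitz_itv_continuous (el i j).
pose T j t := c t * e i1 j t + s t * e i2 j t.
pose N j t := c t * e i2 j t - s t * e i1 j t.
pose k t := cos (f t) / sin (f t).
have dx j t : t \in `]0, Lo[ -> is_derive t 1 (e i0 j) (T j t).
  by move=> /(de j)[].
have dy j t : t \in `]0, Lo[ -> is_derive t 1 (e i1 j) (- c t * e i0 j t).
  by move=> /(de j)[].
have dz j t : t \in `]0, Lo[ -> is_derive t 1 (e i2 j) (- s t * e i0 j t).
  by move=> /(de j)[].
have dT j t : t \in `]0, Lo[ -> is_derive t 1 (T j) (k t * N j t - e i0 j t).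
  by move=> tL; exact: (tangent_derive dTh (dy j) (dz j) tL).
have frange t : t \in `]0, Lo[ -> 0 < f t /\ f t <= t.
  rewrite in_itv/= => /andP[t0 /ltW tL].
  by have [] := admissible_comp a0 a1 aLo fa t0 tL.
have invol j t : 0 < t -> t < Lo ->
    e i0 j t = cos (f t) * e i0 j (f t) - sin (f t) * T j (f t).
  apply: (involute_coordinate Lo1 K0 frange fd dTh ThC (dx j) (dy j) (dz j)) => //.
  by move=> u u0 uL; split; exact: e1.
have Tnorm t : t \in `]0, Lo[ -> \sum_j T j t ^+ 2 = 1.
  rewrite in_itv/= => /andP[/ltW t0 /ltW tL].
  have g11 := gram i1 i1 t t0 tL; have g12 := gram i1 i2 t t0 tL.
  have g22 := gram i2 i2 t t0 tL; rewrite /= in g11 g12 g22.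
  have -> : \sum_j T j t ^+ 2 = c t ^+ 2 * \sum_j e i1 j t * e i1 j t
    + s t ^+ 2 * \sum_j e i2 j t * e i2 j t
    + 2 * (c t * s t) * \sum_j e i1 j t * e i2 j t.
    by rewrite !sum_ord3 /T; ring.
  by rewrite g11 g12 g22 mulr0 addr0 !mulr1; exact: cos2Dsin2.
have T2 j t : 0 <= t -> t <= Lo -> `|T j t| <= 2.
  move=> t0 tL; apply: (le_trans (ler_normD _ _)); rewrite !normrM.
  have h1 : `|c t| * `|e i1 j t| <= 1 * 1 by apply: ler_pM => //;
    [exact: cos_max|exact: e1].
  have h2 : `|s t| * `|e i2 j t| <= 1 * 1 by apply: ler_pM => //;
    [exact: sin_max|exact: e1].
  lra.
have N2 j t : 0 <= t -> t <= Lo -> `|N j t| <= 2.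
  move=> t0 tL; apply: (le_trans (ler_normB _ _)); rewrite !normrM.
  have h1 : `|c t| * `|e i2 j t| <= 1 * 1 by apply: ler_pM => //;
    [exact: cos_max|exact: e1].
  have h2 : `|s t| * `|e i1 j t| <= 1 * 1 by apply: ler_pM => //;
    [exact: sin_max|exact: e1].
  lra.
pose eta t : 'rV[R]_3 := \row_j e i0 j t.
(* At t = 0 the value of T is arbitrary, but it is multiplied by sin 0 = 0, so g starts at the same
   point as the curve. *)
pose g t : 'rV[R]_3 := \row_j (cos t * e i0 j t - sin t * T j t).
have oo t : t \in `]0, L[ -> t \in `]0, Lo[.
  by rewrite !in_itv/= => /andP[-> /lt_trans]; exact.
have deta t : t \in `]0, Lo[ ->
  derivable eta t 1 /\ derive1 eta t = \row_j T j t.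
  move=> tL; apply: derive1_row => j; rewrite mxE.
  rewrite (_ : (fun u => _) = e i0 j); first exact: dx.
  by apply/funext => u; rewrite mxE.
have enormE u v : enorm (eta v - eta u) = Num.sqrt (\sum_j (e i0 j v - e i0 j u) ^+ 2).
  by rewrite /enorm; congr Num.sqrt; apply: eq_bigr => j _; rewrite !mxE.
have arc : arclength_param L eta.
  apply: arclength_param_of_chords => [u v u0 uv vL|r r0].
    rewrite enormE.
    exact: (unit_speed_chord_le (ec i0) dx Tnorm u0 uv (le_trans vL (ltW LLo))).
  (* Bounds the derivative k N - X of the tangent beyond r: k <= 1 / f <= 1 / (a r), while |N| <= 2
     and |X| <= 1 in each coordinate. *)
  pose kappa := (a * r)^-1 * 2 + 1.
  have Tl j : lipschitz_itv kappa r L (T j).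
    have rI t : t \in `[r, L] -> t \in `]0, Lo[.
      rewrite !in_itv/= => /andP[rt tL].
      by rewrite (lt_le_trans r0 rt) (le_lt_trans tL).
    have Tc : {within `[r, L], continuous (T j)}.
      apply: continuous_in_subspaceT => t; rewrite inE/= => /rI tL.
      exact: is_derive1_continuous (dT j t tL).
    have dTr t : t \in `]r, L[ -> is_derive t 1 (T j) (k t * N j t - e i0 j t).
      by move=> /subset_itv_oo_cc /rI; exact: dT.
    have bT t : t \in `]r, L[ -> `|k t * N j t - e i0 j t| <= kappa.
      move=> tI; have tL := rI t (subset_itv_oo_cc tI).
      have [f0 ft] := frange t tL.
      move: tI tL; rewrite !in_itv/= => /andP[rt _] /andP[t0 /ltW tL].
      apply: (le_trans (ler_normB _ _)); apply: lerD;
        last exact: e1 (ltW t0) tL.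
      rewrite normrM; apply: ler_pM => //; last exact: N2 (ltW t0) tL.
      have fL1 : f t <= 1 := le_trans ft (le_trans tL Lo1).
      have /andP[_ kup] := cot_bounds f0 fL1.
      have cf := cos_gt0_unit (ltW f0) fL1; have sf := sin_gt0_unit f0 fL1.
      rewrite ger0_norm; last by rewrite divr_ge0 ?(ltW cf) ?(ltW sf).
      apply: (le_trans kup); rewrite lef_pV2 ?posrE ?mulr_gt0//.
      have [fb _ _] := fa; have /andP[lo _] := fb t (ltW t0) tL.
      by apply: le_trans lo; rewrite ler_pM2l// ltW.
    exact: lipschitz_itv_derive Tc dTr bT.
  exists (3 / 2 * kappa ^+ 2); first by rewrite mulr_ge0// sqr_ge0.
  move=> u v ru uv vL; rewrite enormE.
  have Lr : L - r <= 1 by lra.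
  exact: (unit_speed_chord_ge (ec i0) dx Tnorm r0 LLo Lr Tl ru uv vL).
have C1 : C1_oo 0 L eta.
  split=> [t /oo /deta[]//|t tL].
  have dE : derive1 eta t = \row_j T j t by have [] := deta t (oo t tL).
  rewrite /prop_for /continuous_at dE.
  have : (fun u => \row_j T j u : 'rV[R]_3) @ t --> (\row_j T j t : 'rV[R]_3).
    apply: cvg_row => j; rewrite mxE.
    rewrite (_ : (fun u => _) = T j); last by apply/funext => u; rewrite mxE.
    exact: is_derive1_continuous (dT j t (oo t tL)).
  apply: cvg_trans; apply: near_eq_cvg; near=> u.
  apply/esym; have [] := deta u _ => //; apply: oo.
  by near: u; exact: near_in_itvoo.
(* Only t = 0 is delicate: T may oscillate there, but it is bounded by 2 and damped by the sine. *)
have sTc j : {within `[0, L], continuous (fun t => sin t * T j t)}.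
  apply/subspace_continuousP => t /=; rewrite in_itv/= => /andP[+ tL].
  rewrite le_eqVlt => /predU1P[<-|t0]; last first.
    apply: cvg_within_filter; apply: cvgM; first exact: continuous_sin.
    apply: (is_derive1_continuous (dT j t _)).
    by rewrite in_itv/= t0 (le_lt_trans tL).
  rewrite /from_subspace sin0 mul0r; apply/cvgrPdist_le => r r0.
  rewrite near_withinE; near=> u; rewrite /= in_itv/= => /andP[u0 uL].
  have ur : `|0 - u| <= r / 2.
    by near: u; apply: (@cvgr_dist_le _ _ _ _ _ id); rewrite ?divr_gt0//;
      exact: cvg_id.
  rewrite sub0r normrN normrM (_ : r = r / 2 * 2); last by field.
  apply: ler_pM => //; last by apply: T2 => //; exact: le_trans (ltW LLo).
  have := sin_dist_le u 0; rewrite sin0 !subr0 => /le_trans; apply.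
  by rewrite -normrN -sub0r.
have gc : {within `[0, L], continuous g}.
  apply/subspace_continuousP => t tL; apply: cvg_row => j.
  rewrite mxE (_ : (fun u => _) = (fun u => cos u * e i0 j u - sin u * T j u)).
    have : {within `[0, L], continuous (fun u =>
      cos u * e i0 j u - sin u * T j u)}.
      apply: within_continuousB (sTc j); apply: within_continuousM.
        exact/continuous_subspaceT/continuous_cos.
      exact: within_continuous_sub (ec i0 j) (lexx 0) (ltW LLo).
    by move/subspace_continuousP; apply.
  by apply/funext => u; rewrite mxE.
have g_inv : is_involute L eta g.
  split=> // t tL; have [_ ->] := deta t (oo t tL).
  by apply/rowP => j; rewrite !mxE.
have f0 := admissible0 Lo0 fa.
have etag t : 0 <= t -> t <= L -> eta t = g (f t).
  rewrite le_eqVlt => /predU1P[<- _|t0 tL]; apply/rowP => j; rewrite !mxE.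
    by rewrite f0 cos0 sin0 mul1r mul0r subr0.
  by apply: invol => //; exact: le_lt_trans LLo.
have fc : {within `[0, L], continuous f}.
  have [_ _ fl] := fa.
  exact: within_continuous_sub (lipschitz_itv_continuous fl) (lexx 0) (ltW LLo).
have len t : 0 <= t -> t <= L -> curve_length 0 (f t) g = t%:E.
  apply: (curve_length_reparam f0 _ fc arc etag) => u v u0 uv vL.
  by apply: (admissible_lt a0 fa) => //; exact: le_trans (ltW LLo).
exists eta; split.
  split=> // t; rewrite in_itv/= => /andP[t0 tL].
  rewrite /unit_sphere/= /enorm.
  have := gram i0 i0 t t0 (le_trans tL (ltW LLo)); rewrite /= => g1.
  rewrite (_ : \sum_i _ = 1) ?sqrtr1//.
  by apply: etrans g1; apply: eq_bigr => j _; rewrite !mxE expr2.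
(* As the curve at t is g at f t, the arc of g of length L ends at parameter f L <= L. *)
exists g; split=> //; exists (f L); split.
- have [|fL0 fLL] := frange L; first by rewrite in_itv/= L0.
  by rewrite (ltW fL0) fLL.
- by apply: len => //; exact: ltW.
- move=> u; rewrite in_itv/= => /andP[u0 ufL].
  have [|t tI <-] := IVT (ltW L0) fc (v := u).
    by rewrite f0 ge_min le_max u0 ufL orbT.
  move: tI; rewrite in_itv/= => /andP[t0 tL].
  by rewrite len//= etag.
Unshelve. all: by end_near. Qed.

Theorem corollary4p6 (R : realType) :
  exists Lo : R, 0 < Lo /\
    forall L : R, 0 < L -> L < Lo ->
      exists eta : R -> 'rV[R]_3, self_involute L eta.
Proof.
(* b ln b is positive for b > 1, so -pi/2 is replaced by its least positive representative modulo 2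
   pi. *)
have M0 : 0 < 3 * (pi / 2) :> R by have := one_lt_pihalf R; lra.
have [b [b1 bM]] := exists_mul_ln M0.
have b0 : 0 < b by lra.
have a0 : 0 < b^-1 by rewrite invr_gt0.
have a1 : b^-1 < 1 by rewrite invf_lt1.
(* 1/6 makes the Picard step for three unknowns halve distances; the second bound, with Lo <= 1,
   gives 9 Lo^2 <= 1 - a for a = 1/b. *)
pose Lo := Num.min (6^-1) ((1 - b^-1) / 9).
have Lo0 : 0 < Lo by rewrite lt_min; apply/andP; split; lra.
have Lo6 : Lo <= 6^-1 by rewrite ge_min lexx.
have Lo9 : Lo <= (1 - b^-1) / 9 by rewrite ge_min lexx orbT.
exists Lo; split=> //; apply: (self_involute_exists a0 a1) => //.
  by rewrite invrK.
have : Lo ^+ 2 <= Lo by rewrite expr2 ler_piMl ?(ltW Lo0)//; lra.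
lra.
Qed.
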